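(* Translation preserves typeability: (1) if $\Delta|\Gamma\vdash_Q t:A_Q$ then $[\![\Delta]\!],[\![\Gamma]\!]\vdash[\![t]\!]:[\![A_Q]\!]$ is a valid typing judgment; (2) if $\Delta\vdash_C t:A$ then $[\![\Delta]\!]\vdash[\![t]\!]:[\![A]\!]$ is valid; (3) if the program $[Q,L,t]$ is well-typed of type $A_Q$ then $\vdash[\![[Q,L,t]]\!]:[\![A_Q]\!]$ is valid.
   Context: Target calculus and typing. Pure values $v::=x\mid\lambda x.\vec{s}\mid *\mid (v_1,v_2)\mid \mathtt{inl}(v)\mid\mathtt{inr}(v)$; pure terms add $s\,t$, $t;\vec s$, $\mathtt{let}\,(x_1,x_2)=t\,\mathtt{in}\,\vec s$, $\mathtt{match}\,t\{\mathtt{inl}\,x_1\mapsto\vec s_1\mid\mathtt{inr}\,x_2\mapsto\vec s_2\}$; term distributions are formal $\mathbb C$-combinations modulo the weak-vector-space congruence (not acting inside pure terms); constructs extend by linearity; $\vec t\langle x:=\vec w\rangle=\sum_j\beta_j\vec t[x:=w_j]$; evaluation $\succ^*$ is linear call-by-value. Types $\mathbb U,\flat A,\sharp A,A+B,A\times B,A\rightarrow B,A\Rightarrow B$ are interpreted as sets of unit-norm closed value distributions: $[\![\mathbb U]\!]=\{*\}$, $[\![\flat A]\!]$ = set of pure values in the domains of elements of $[\![A]\!]$, $[\![\sharp A]\!]=\mathrm{Span}([\![A]\!])\cap\mathcal S$, sums/products componentwise, $[\![A\rightarrow B]\!]=\{\lambda x.\vec t\ \text{closed}:\forall\vec v\in[\![A]\!],\vec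 t\langle x:=\vec v\rangle\Vdash B\}$, $[\![A\Rightarrow B]\!]=\{(\sum_i\alpha_i\lambda x.\vec t_i)\in\mathcal S:\forall\vec v\in[\![A]\!],\sum_i\alpha_i\vec t_i\langle x:=\vec v\rangle\Vdash B\}$, with $\vec t\Vdash B$ iff $\vec t\succ^*\vec v\in[\![B]\!]$. $\mathbb B=\mathbb U+\mathbb U$, $A\otimes B=\sharp(A\times B)$, $\mathtt{tt}=\mathtt{inl}( * )$, $\mathtt{ff}=\mathtt{inr}( * )$. For a context $\Gamma$ (finite map variables to types), $[\![\Gamma]\!]$ is the set of maps $\sigma$ with $\sigma(x)\in[\![\Gamma(x)]\!]$, $\vec t\langle\sigma\rangle$ iterated bilinear substitution, $\mathrm{dom}^\sharp(\Gamma)=\{x:[\![\Gamma(x)]\!]\neq[\![\flat\Gamma(x)]\!]\}$; $\Gamma\vdash\vec t:A$ is valid iff $\mathrm{dom}^\sharp(\Gamma)\subseteq FV(\vec t)\subseteq\mathrm{dom}(\Gamma)$ and $\vec t\langle\sigma\rangle\Vdash A$ for all $\sigma\in[\![\Gamma]\!]$. Source language $\lambda_Q$. Classical types $A,B::=\mathbb U\mid A\to B\mid A\times B\mid\mathsf{bit}\mid A_Q\multimap B_Q$; quantum types $A_Q,B_Q::=\mathsf{qbit}\mid A_Q\otimes B_Q$. Terms $t,r,s::=x\mid *\mid\lambda x.t\mid t\,r\mid(t,r)\mid\pi_1(t)\mid\pi_2(t)\mid\mathtt{tt}\mid\mathtt{ff}\mid\mathtt{if}\,t\,\mathtt{then}\,r\,\mathtt{else}\,s\mid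 t\otimes r\mid\mathtt{let}\,x\otimes y=t\,\mathtt{in}\,r\mid\mathsf{new}(t)\mid U(t)\mid\lambda^Qx.t\mid t@r$ ($U$ ranging over unitary $2\times2$ matrices). Classical judgments $\Delta\vdash_C t:A$ ($\Delta$ a context of classical types): $\Delta,x:A\vdash_C x:A$; $\Delta\vdash_C *:\mathbb U$; from $\Delta,x:A\vdash_C t:B$ infer $\Delta\vdash_C\lambda x.t:A\to B$; from $\Delta\vdash_C t:A\to B$ and $\Delta\vdash_C r:A$ infer $\Delta\vdash_C t\,r:B$; from $\Delta\vdash_C t:A$, $\Delta\vdash_C r:B$ infer $\Delta\vdash_C(t,r):A\times B$; from $\Delta\vdash_C t:A\times B$ infer $\Delta\vdash_C\pi_1t:A$ and $\Delta\vdash_C\pi_2t:B$; $\Delta\vdash_C\mathtt{tt}:\mathsf{bit}$, $\Delta\vdash_C\mathtt{ff}:\mathsf{bit}$; from $\Delta\vdash_C t:\mathsf{bit}$, $\Delta\vdash_C r:A$, $\Delta\vdash_C s:A$ infer $\Delta\vdash_C\mathtt{if}\,t\,\mathtt{then}\,r\,\mathtt{else}\,s:A$; from $\Delta|x:A_Q\vdash_Q t:B_Q$ infer $\Delta\vdash_C\lambda^Qx.t:A_Q\multimap B_Q$. Quantum judgments $\Delta|\Gamma\vdash_Q t:A_Q$ ($\Gamma$ a context of quantum types, used linearly): $\Delta|x:A_Q\vdash_Q x:A_Q$; from $\Delta|\Gamma_1\vdash_Q s:A_Q$, $\Delta|\Gamma_2\vdash_Q t:B_Q$ infer $\Delta|\Gamma_1,\Gamma_2\vdash_Q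 s\otimes t:A_Q\otimes B_Q$; from $\Delta|\Gamma\vdash_Q t:\mathsf{qbit}$ infer $\Delta|\Gamma\vdash_Q U(t):\mathsf{qbit}$; from $\Delta|\Gamma_1\vdash_Q s:A_Q\otimes B_Q$ and $\Delta|\Gamma_2,x:A_Q,y:B_Q\vdash_Q t:C_Q$ infer $\Delta|\Gamma_1,\Gamma_2\vdash_Q\mathtt{let}\,x\otimes y=s\,\mathtt{in}\,t:C_Q$; from $\Delta\vdash_C t:\mathsf{bit}$ infer $\Delta|\emptyset\vdash_Q\mathsf{new}(t):\mathsf{qbit}$; from $\Delta\vdash_C s:A_Q\multimap B_Q$ and $\Delta|\Gamma\vdash_Q t:A_Q$ infer $\Delta|\Gamma\vdash_Q s@t:B_Q$. A program $[Q,L,t]$ consists of a term $t$, a bijection $L$ from $FV(t)$ to $\{1,\ldots,n\}$ and a unit vector $Q\in(\mathbb C^2)^{\otimes n}$; it is well-typed of type $A_Q$ when $\emptyset|x_1:\mathsf{qbit},\ldots,x_n:\mathsf{qbit}\vdash_Q t:A_Q$ with $\{x_1,\ldots,x_n\}=FV(t)$. Translation. Types: $[\![\mathsf{bit}]\!]=\mathbb B$, $[\![\mathbb U]\!]=\mathbb U$, $[\![A\times B]\!]=[\![A]\!]\times[\![B]\!]$, $[\![A\to B]\!]=[\![A]\!]\rightarrow[\![B]\!]$, $[\![A_Q\multimap B_Q]\!]=\mathbb U\rightarrow([\![A_Q]\!]\Rightarrow[\![B_Q]\!])$, $[\![\mathsf{qbit}]\!]=\sharp\mathbb B$, $[\![A_Q\otimes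 B_Q]\!]=\sharp([\![A_Q]\!]\times[\![B_Q]\!])$; contexts pointwise. Terms: $[\![x]\!]=x$, $[\![*]\!]=*$, $[\![\lambda x.t]\!]=\lambda x.[\![t]\!]$, $[\![t\,r]\!]=[\![t]\!]\,[\![r]\!]$, $[\![(t,r)]\!]=([\![t]\!],[\![r]\!])$, $[\![\mathtt{if}\,t\,\mathtt{then}\,r\,\mathtt{else}\,s]\!]=\mathtt{match}\,[\![t]\!]\{\mathtt{inl}\,z_1\mapsto z_1;[\![r]\!]\mid\mathtt{inr}\,z_2\mapsto z_2;[\![s]\!]\}$ ($z_i$ fresh), $[\![\mathtt{tt}]\!]=\mathtt{inl}( * )$, $[\![\mathtt{ff}]\!]=\mathtt{inr}( * )$, $[\![\pi_i(t)]\!]=\mathtt{let}\,(x_1,x_2)=[\![t]\!]\,\mathtt{in}\,x_i$, $[\![\mathsf{new}(t)]\!]=[\![t]\!]$, $[\![U(t)]\!]=\bar U\,[\![t]\!]$ where for $U=\begin{pmatrix}a&b\\c&d\end{pmatrix}$, $\bar U=\lambda x.\mathtt{match}\,x\{\mathtt{inl}\,x_1\mapsto a\cdot\mathtt{inl}(x_1)+c\cdot\mathtt{inr}(x_1)\mid\mathtt{inr}\,x_2\mapsto b\cdot\mathtt{inl}(x_2)+d\cdot\mathtt{inr}(x_2)\}$, $[\![t\otimes r]\!]=([\![t]\!],[\![r]\!])$, $[\![\mathtt{let}\,x\otimes y=s\,\mathtt{in}\,t]\!]=\mathtt{let}\,(x,y)=[\![s]\!]\,\mathtt{in}\,[\![t]\!]$,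 $[\![\lambda^Qx.t]\!]=\lambda z.\lambda x.[\![t]\!]$ ($z$ fresh), $[\![t@r]\!]=([\![t]\!]\,* )\,[\![r]\!]$. Programs: $[\![[\sum_{i=1}^m\alpha_i|y^i_1\ldots y^i_n\rangle,\{x_1\mapsto p(1),\ldots,x_n\mapsto p(n)\},t]]\!]=\sum_{i=1}^m\alpha_i\cdot[\![t]\!][x_1:=\bar y^i_{p(1)},\ldots,x_n:=\bar y^i_{p(n)}]$ with $y^i_j\in\{0,1\}$, $\bar0=\mathtt{tt}$, $\bar1=\mathtt{ff}$. *)

(* Defs.v *)
From mathcomp Require Import all_boot all_algebra.
From mathcomp Require Import complex.
From mathcomp Require Import reals Rstruct.
From Stdlib Require Import List Permutation.
Import GRing.Theory Num.Theory.

Set Implicit Arguments.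
Unset Strict Implicit.
Unset Printing Implicit Defensive.

Definition C : numClosedFieldType := (Rdefinitions.R)[i].

(* Binding conventions:
   - [Lam d]            : d binds index 0 (the lambda variable x);
   - [Let t d]          : let (x1,x2) = t in d, x1 is index 1, x2 is index 0;
   - [Match t d1 d2]    : in d1 (resp. d2) the variable x1 (resp. x2) is index 0;
   - [Seq t d]          : t ; d  (no binder).
   Raw term distributions [dist] are formal expressions built from pure terms,
   scalar multiplication and sums; they are only considered modulo the weak
   vector space congruence [dequiv] at top level (never inside pure terms). *)
Inductive term : Type :=
| Var   of nat
| Lam   of dist
| Unit
| Pair  of term & term
| Inl   of term
| Inr   of term
| App   of term & term
| Seq   of term & dist
| Let   of term & dist
| Match of term & dist & dist
with dist : Type :=
| DT    of term
| DScal of C & dist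
| DAdd  of dist & dist.

Fixpoint is_val (t : term) : Prop :=
  match t with
  | Var _ | Lam _ | Unit => True
  | Pair v w => is_val v /\ is_val w
  | Inl v | Inr v => is_val v
  | _ => False
  end.

Fixpoint leaves (d : dist) : list term :=
  match d with
  | DT t => t :: nil
  | DScal _ d => leaves d
  | DAdd d e => leaves d ++ leaves e
  end.

Fixpoint occT (n : nat) (t : term) : bool :=
  match t with
  | Var m => m == n
  | Lam d => occD n.+1 d
  | Unit => false
  | Pair s u | App s u => occT n s || occT n u
  | Inl s | Inr s => occT n s
  | Seq s d => occT n s || occD n d
  | Let s d => occT n s || occD n.+2 d
  | Match s d1 d2 => [|| occT n s, occD n.+1 d1 | occD n.+1 d2]
  end
with occD (n : nat) (d : dist) : bool :=
  match d with
  | DT t => occT n t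
  | DScal _ d => occD n d
  | DAdd d e => occD n d || occD n e
  end.

Definition closedT (t : term) : Prop := forall n, occT n t = false.
Definition closedD (d : dist) : Prop := forall n, occD n d = false.

Definition cvdist (d : dist) : Prop :=
  closedD d /\ forall t, In t (leaves d) -> is_val t.

(* substitution of a (closed) pure value w for index k, removing that index *)
Fixpoint substT (k : nat) (w : term) (t : term) : term :=
  match t with
  | Var n => if n < k then Var n else if n == k then w else Var n.-1
  | Lam d => Lam (substD k.+1 w d)
  | Unit => Unit
  | Pair s u => Pair (substT k w s) (substT k w u)
  | Inl s => Inl (substT k w s)
  | Inr s => Inr (substT k w s)
  | App s u => App (substT k w s) (substT k w u)
  | Seq s d => Seq (substT k w s) (substD k w d)
  | Let s d => Let (substT k w s) (substD k.+2 w d)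
  | Match s d1 d2 => Match (substT k w s) (substD k.+1 w d1) (substD k.+1 w d2)
  end
with substD (k : nat) (w : term) (d : dist) : dist :=
  match d with
  | DT t => DT (substT k w t)
  | DScal a d => DScal a (substD k w d)
  | DAdd d e => DAdd (substD k w d) (substD k w e)
  end.

Fixpoint dmap (f : term -> dist) (d : dist) : dist :=
  match d with
  | DT t => f t
  | DScal a d => DScal a (dmap f d)
  | DAdd d e => DAdd (dmap f d) (dmap f e)
  end.

Definition lsubst (d w : dist) : dist := dmap (fun v => substD 0 v d) w.

(* iterated bilinear substitution d<sigma>; sigma's i-th entry is for index i *)
Definition close (d : dist) (sigma : list dist) : dist :=
  fold_left lsubst sigma d.

Definition dinl (d : dist) : dist := dmap (fun t => DT (Inl t)) d.
Definition dinr (d : dist) : dist := dmap (fun t => DT (Inr t)) d.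
Definition dpair (d e : dist) : dist :=
  dmap (fun s => dmap (fun t => DT (Pair s t)) e) d.

Inductive dequiv : dist -> dist -> Prop :=
| deq_refl d : dequiv d d
| deq_sym d e : dequiv d e -> dequiv e d
| deq_trans d e f : dequiv d e -> dequiv e f -> dequiv d f
| deq_add d d' e e' : dequiv d d' -> dequiv e e' -> dequiv (DAdd d e) (DAdd d' e')
| deq_scal a d d' : dequiv d d' -> dequiv (DScal a d) (DScal a d')
| deq_comm d e : dequiv (DAdd d e) (DAdd e d)
| deq_assoc d e f : dequiv (DAdd (DAdd d e) f) (DAdd d (DAdd e f))
| deq_one d : dequiv (DScal 1%R d) d
| deq_scalA a b d : dequiv (DScal a (DScal b d)) (DScal (a * b)%R d)
| deq_scalDl a b d : dequiv (DScal (a + b)%R d) (DAdd (DScal a d) (DScal b d))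
| deq_scalDr a d e : dequiv (DScal a (DAdd d e)) (DAdd (DScal a d) (DScal a e)).

Definition lcomb (h : C * dist) (l : list (C * dist)) : dist :=
  fold_left (fun acc p => DAdd acc (DScal (fst p) (snd p)))
            l (DScal (fst h) (snd h)).

Definition sphere (d : dist) : Prop :=
  exists (h : C * term) (l : list (C * term)),
    NoDup (map snd (h :: l)) /\
    dequiv d (lcomb (fst h, DT (snd h)) (map (fun p => (fst p, DT (snd p))) l)) /\
    (\sum_(p <- h :: l) `|fst p| ^+ 2)%R = 1%R.

Definition span (X : dist -> Prop) (d : dist) : Prop :=
  exists (h : C * dist) (l : list (C * dist)),
    X (snd h) /\ (forall p, In p l -> X (snd p)) /\ dequiv d (lcomb h l).

Inductive red1 : term -> dist -> Prop :=
| r_beta d v : is_val v -> red1 (App (Lam d) v) (substD 0 v d)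
| r_seq d : red1 (Seq Unit d) d
| r_let v1 v2 d : is_val v1 -> is_val v2 ->
    red1 (Let (Pair v1 v2) d) (substD 0 v1 (substD 0 v2 d))
| r_inl v d1 d2 : is_val v -> red1 (Match (Inl v) d1 d2) (substD 0 v d1)
| r_inr v d1 d2 : is_val v -> red1 (Match (Inr v) d1 d2) (substD 0 v d2)
| r_appR s t e : red1 t e -> red1 (App s t) (dmap (fun t' => DT (App s t')) e)
| r_appL s v e : is_val v -> red1 s e -> red1 (App s v) (dmap (fun s' => DT (App s' v)) e)
| r_pairR s t e : red1 t e -> red1 (Pair s t) (dmap (fun t' => DT (Pair s t')) e)
| r_pairL s v e : is_val v -> red1 s e -> red1 (Pair s v) (dmap (fun s' => DT (Pair s' v)) e)
| r_inlC t e : red1 t e -> red1 (Inl t) (dinl e)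
| r_inrC t e : red1 t e -> red1 (Inr t) (dinr e)
| r_seqC t d e : red1 t e -> red1 (Seq t d) (dmap (fun t' => DT (Seq t' d)) e)
| r_letC t d e : red1 t e -> red1 (Let t d) (dmap (fun t' => DT (Let t' d)) e)
| r_matchC t d1 d2 e : red1 t e ->
    red1 (Match t d1 d2) (dmap (fun t' => DT (Match t' d1 d2)) e).

Inductive dstep : dist -> dist -> Prop :=
| ds_term t e : red1 t e -> dstep (DT t) e
| ds_scal a d e : dstep d e -> dstep (DScal a d) (DScal a e)
| ds_addL d e d' : dstep d d' -> dstep (DAdd d e) (DAdd d' e)
| ds_addR d e e' : dstep e e' -> dstep (DAdd d e) (DAdd d e').

Inductive evals : dist -> dist -> Prop :=
| ev_refl d e : dequiv d e -> evals d e
| ev_step d d' e' f : dequiv d d' -> dstep d' e' -> evals e' f -> evals d f.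

Inductive ttype : Type :=
| TU
| TFlat of ttype
| TSharp of ttype
| TSum of ttype & ttype
| TProd of ttype & ttype
| TArr of ttype & ttype
| TDarr of ttype & ttype.

Definition realizes (d : dist) (X : dist -> Prop) : Prop :=
  exists e, evals d e /\ X e.

Fixpoint interp (A : ttype) : dist -> Prop :=
  match A with
  | TU => fun d => dequiv d (DT Unit)
  | TFlat A => fun d => exists v e, dequiv d (DT v) /\ interp A e /\ In v (leaves e)
  | TSharp A => fun d => span (interp A) d /\ sphere d
  | TSum A B => fun d =>
      (exists e, interp A e /\ dequiv d (dinl e)) \/
      (exists e, interp B e /\ dequiv d (dinr e))
  | TProd A B => fun d =>
      exists e f, interp A e /\ interp B f /\ dequiv d (dpair e f)
  | TArr A B => fun d =>
      exists body, dequiv d (DT (Lam body)) /\ closedT (Lam body) /\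
        forall v, interp A v -> realizes (lsubst body v) (interp B)
  | TDarr A B => fun d =>
      exists (h : C * dist) (l : list (C * dist)),
        dequiv d (lcomb (fst h, DT (Lam (snd h)))
                        (map (fun p => (fst p, DT (Lam (snd p)))) l)) /\
        (forall p, In p (h :: l) -> closedT (Lam (snd p))) /\
        sphere d /\
        forall v, interp A v ->
          realizes (lcomb (fst h, lsubst (snd h) v)
                          (map (fun p => (fst p, lsubst (snd p) v)) l))
                   (interp B)
  end.

Definition TB : ttype := TSum TU TU.

(* validity of Gamma |- d : A; Gamma's i-th entry types index i *)
Definition valid (G : list ttype) (d : dist) (A : ttype) : Prop :=
  (forall i, i < length G ->
     ~ (forall e, interp (nth i G TU) e <-> interp (TFlat (nth i G TU)) e) ->
     occD i d = true) /\
  (forall i, occD i d = true -> i < length G) /\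
  (forall sigma : list dist, length sigma = length G ->
     (forall i, i < length G -> interp (nth i G TU) (nth i sigma (DT Unit))) ->
     realizes (close d sigma) (interp A)).

Definition unitary2 (U : 'M[C]_2) : Prop :=
  (U *m (map_mx Num.conj U)^T = 1%:M)%R.

Record gate : Type := Gate { gmx : 'M[C]_2 ; gmx_unitary : unitary2 gmx }.

Inductive ctype : Type :=
| CUnit
| CArr of ctype & ctype
| CProd of ctype & ctype
| CBit
| CLoll of qtype & qtype
with qtype : Type :=
| QBit
| QTens of qtype & qtype.

Inductive sterm : Type :=
| SVar of nat
| SStar
| SLam of nat & sterm
| SApp of sterm & sterm
| SPair of sterm & sterm
| SPi1 of sterm
| SPi2 of sterm
| STT
| SFF
| SIf of sterm & sterm & sterm
| STens of sterm & sterm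
| SLetT of nat & nat & sterm & sterm   (* let x (x) y = s in t *)
| SNew of sterm
| SGate of gate & sterm
| SLamQ of nat & sterm
| SAppQ of sterm & sterm.

Fixpoint sfv (t : sterm) : list nat :=
  match t with
  | SVar x => x :: nil
  | SStar | STT | SFF => nil
  | SLam x t | SLamQ x t => filter (fun y => y != x) (sfv t)
  | SApp t r | SPair t r | STens t r | SAppQ t r => sfv t ++ sfv r
  | SPi1 t | SPi2 t | SNew t | SGate _ t => sfv t
  | SIf t r s => sfv t ++ sfv r ++ sfv s
  | SLetT x y s t => sfv s ++ filter (fun z => (z != x) && (z != y)) (sfv t)
  end.

Definition names {T : Type} (G : list (nat * T)) : list nat := map fst G.

(* Contexts are finite maps, represented by duplicate-free lists; the
   quantum context is taken up to permutation. *)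
Inductive ctyping : list (nat * ctype) -> sterm -> ctype -> Prop :=
| ct_var D x A : In (x, A) D -> ctyping D (SVar x) A
| ct_star D : ctyping D SStar CUnit
| ct_lam D x A B t : ~ In x (names D) ->
    ctyping ((x, A) :: D) t B -> ctyping D (SLam x t) (CArr A B)
| ct_app D t r A B : ctyping D t (CArr A B) -> ctyping D r A -> ctyping D (SApp t r) B
| ct_pair D t r A B : ctyping D t A -> ctyping D r B -> ctyping D (SPair t r) (CProd A B)
| ct_pi1 D t A B : ctyping D t (CProd A B) -> ctyping D (SPi1 t) A
| ct_pi2 D t A B : ctyping D t (CProd A B) -> ctyping D (SPi2 t) B
| ct_tt D : ctyping D STT CBit
| ct_ff D : ctyping D SFF CBit
| ct_if D t r s A : ctyping D t CBit -> ctyping D r A -> ctyping D s A ->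
    ctyping D (SIf t r s) A
| ct_lamQ D x AQ BQ t : ~ In x (names D) ->
    qtyping D ((x, AQ) :: nil) t BQ -> ctyping D (SLamQ x t) (CLoll AQ BQ)
with qtyping : list (nat * ctype) -> list (nat * qtype) -> sterm -> qtype -> Prop :=
| qt_var D x AQ : qtyping D ((x, AQ) :: nil) (SVar x) AQ
| qt_tens D G G1 G2 s t AQ BQ : qtyping D G1 s AQ -> qtyping D G2 t BQ ->
    Permutation G (G1 ++ G2) -> qtyping D G (STens s t) (QTens AQ BQ)
| qt_gate D G U t : qtyping D G t QBit -> qtyping D G (SGate U t) QBit
| qt_let D G G1 G2 x y s t AQ BQ CQ :
    ~ In x (names D) -> ~ In y (names D) -> x <> y ->
    ~ In x (names G2) -> ~ In y (names G2) ->
    qtyping D G1 s (QTens AQ BQ) ->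
    qtyping D ((x, AQ) :: (y, BQ) :: G2) t CQ ->
    Permutation G (G1 ++ G2) -> qtyping D G (SLetT x y s t) CQ
| qt_new D t : ctyping D t CBit -> qtyping D nil (SNew t) QBit
| qt_appQ D G s t AQ BQ : ctyping D s (CLoll AQ BQ) -> qtyping D G t AQ ->
    qtyping D G (SAppQ s t) BQ.

Fixpoint trQ (A : qtype) : ttype :=
  match A with
  | QBit => TSharp TB
  | QTens A B => TSharp (TProd (trQ A) (trQ B))
  end.

Fixpoint trC (A : ctype) : ttype :=
  match A with
  | CUnit => TU
  | CArr A B => TArr (trC A) (trC B)
  | CProd A B => TProd (trC A) (trC B)
  | CBit => TB
  | CLoll A B => TArr TU (TDarr (trQ A) (trQ B))
  end.

Definition ttrue : term := Inl Unit.
Definition tfalse : term := Inr Unit.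

Definition Ubar (U : gate) : term :=
  let M := gmx U in
  Lam (DT (Match (Var 0)
    (DAdd (DScal (M ord0 ord0) (DT (Inl (Var 0)))) (DScal (M ord_max ord0) (DT (Inr (Var 0)))))
    (DAdd (DScal (M ord0 ord_max) (DT (Inl (Var 0)))) (DScal (M ord_max ord_max) (DT (Inr (Var 0))))))).

(* environment: the name bound at each de Bruijn index (None = fresh) *)
Definition env := list (option nat).

Fixpoint idx (e : env) (x : nat) : nat :=
  match e with
  | nil => 0
  | o :: e => if o == Some x then 0 else (idx e x).+1
  end.

Fixpoint tr (e : env) (t : sterm) : term :=
  match t with
  | SVar x => Var (idx e x)
  | SStar => Unit
  | SLam x t => Lam (DT (tr (Some x :: e) t))
  | SApp t r => App (tr e t) (tr e r)
  | SPair t r => Pair (tr e t) (tr e r)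
  | SPi1 t => Let (tr e t) (DT (Var 1))
  | SPi2 t => Let (tr e t) (DT (Var 0))
  | STT => ttrue
  | SFF => tfalse
  | SIf t r s => Match (tr e t) (DT (Seq (Var 0) (DT (tr (None :: e) r))))
                                (DT (Seq (Var 0) (DT (tr (None :: e) s))))
  | STens t r => Pair (tr e t) (tr e r)
  | SLetT x y s t => Let (tr e s) (DT (tr (Some y :: Some x :: e) t))
  | SNew t => tr e t
  | SGate U t => App (Ubar U) (tr e t)
  | SLamQ x t => Lam (DT (Lam (DT (tr (Some x :: None :: e) t))))
  | SAppQ t r => App (App (tr e t) Unit) (tr e r)
  end.

Definition envOf {T : Type} (G : list (nat * T)) : env := map (fun p => Some (fst p)) G.

(* Programs [Q, L, t]: the state Q is given as a formal sum
   sum_{i=1}^m alpha_i |y^i_1 ... y^i_n>  (list [kets]); the bijection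
   L : FV(t) -> {1..n} is given by the duplicate-free list [xs] with
   L (nth k xs) = k+1. *)
Definition ket (n : nat) := {ffun 'I_n -> bool}.   (* true = 1, false = 0 *)

Definition state_vec n (kets : list (C * ket n)) (y : ket n) : C :=
  (\sum_(p <- kets | snd p == y) fst p)%R.

Definition bitval (b : bool) : term := if b then tfalse else ttrue.

Definition tr_prog n (h : C * ket n) (kets : list (C * ket n))
    (xs : n.-tuple nat) (t : sterm) : dist :=
  let body := DT (tr (map Some xs) t) in
  let inst (y : ket n) := close body [seq DT (bitval (y k)) | k <- enum 'I_n] in
  lcomb (fst h, inst (snd h)) (map (fun p => (fst p, inst (snd p))) kets).

(* Main.v *)
Require Import Defs.
From mathcomp Require Import all_boot all_algebra.
From mathcomp Require Import boolp zify ring.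
From Stdlib Require Import List Permutation.
Import GRing.Theory Num.Theory.

(** For fixed classical values, the translation of a quantum term sends the basis
    assignments of its quantum context to an orthonormal family of value distributions
    (induction on typing); a translated quantum type is the unit sphere of the span of
    its basis values, so every unit input is then mapped to a unit output.  The one
    place where orthonormality is not obtained by composing smaller isometries is the
    application of an arbitrary realizer of [A_Q -o B_Q]: there it follows, by
    polarization, from the fact that unit vectors are mapped to unit vectors, which
    uses that evaluation has at most one result up to the weak-vector-space congruence. *)

Set Implicit Arguments.
Unset Strict Implicit.
Unset Printing Implicit Defensive.

(* Otherwise [simpl] replaces [C] by its carrier in types and ring structures are lost. *)
#[local] Opaque C.

(** * Linear functionals and inner product *)

(* Validity quantifies over substitutions that give each variable its own unit vector, that is, over
   product states, whereas [let] receives the two components of a possibly entangled vector and a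
   program starts from an arbitrary state. Validity of a subterm does not speak directly about such
   inputs; orthonormality of the images of basis assignments does, by linearity, which is why it is
   the property carried through the induction. The congruence is weaker than equality in a vector
   space: a term with coefficient 0 is kept, so vectors cannot be cancelled. Metric reasoning
   therefore passes to complex numbers through the congruence-invariant form [ip], while membership
   in the span of a basis is read off the support. *)
Scheme term_mut := Induction for term Sort Prop
  with dist_mut := Induction for dist Sort Prop.
Combined Scheme term_dist_ind from term_mut, dist_mut.

Section LinearExtension.
Local Open Scope ring_scope.

(** Terms carry complex scalars, so their equality is decided classically. Syntactic equality is the
    right one, since the congruence does not act inside pure terms. *)
Definition ind (P : Prop) : C := (`[< P >] : bool)%:R.

Lemma ind_true (P : Prop) : P -> ind P = 1.
Proof. by move=> h; rewrite /ind asboolT. Qed.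

Lemma ind_false (P : Prop) : ~ P -> ind P = 0.
Proof. by move=> h; rewrite /ind asboolF. Qed.

Lemma ind_iff (P Q : Prop) : (P <-> Q) -> ind P = ind Q.
Proof. by move=> h; rewrite /ind (asbool_equiv_eq h). Qed.

Lemma ind_and (P Q : Prop) : ind (P /\ Q) = ind P * ind Q.
Proof.
case: (pselect P) => p; last by rewrite (ind_false p) mul0r ind_false // => -[].
by rewrite (ind_true p) mul1r; apply: ind_iff; split=> [[]|].
Qed.

Lemma conj_ind (P : Prop) : (ind P)^* = ind P.
Proof. by rewrite /ind conjC_nat. Qed.

Fixpoint dsum (f : term -> C) (d : dist) : C :=
  match d with
  | DT t => f t
  | DScal a d => a * dsum f d
  | DAdd d e => dsum f d + dsum f e
  end.

Lemma eq_in_dsum f g d :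
  (forall t, In t (leaves d) -> f t = g t) -> dsum f d = dsum g d.
Proof.
elim: d => [t|a d IH|d IHd e IHe] /= h; first by apply: h; left.
  by rewrite IH.
by rewrite IHd ?IHe // => t ht; apply: h; apply/in_app_iff; [right|left].
Qed.

(** Under a linear functional every axiom of the congruence becomes an identity of [C]; the
    invariance of [coef] and [ip] comes from here. *)
Lemma dsum_equiv f d e : dequiv d e -> dsum f d = dsum f e.
Proof.
elim=> {d e} //=.
- by move=> d e f' _ -> _ ->.
- by move=> d d' e e' _ -> _ ->.
- by move=> a d d' _ ->.
- by move=> d e; rewrite addrC.
- by move=> d e f'; rewrite addrA.
- by move=> d; rewrite mul1r.
- by move=> a b d; rewrite mulrA.
- by move=> a b d; rewrite mulrDl.
- by move=> a d e; rewrite mulrDr.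
Qed.

Lemma dsumD f g d : dsum (fun t => f t + g t) d = dsum f d + dsum g d.
Proof. by elim: d => [t|a d IH|d IHd e IHe] //=; rewrite ?IH ?IHd ?IHe ?mulrDr // addrACA. Qed.

Lemma dsumZ a f d : dsum (fun t => a * f t) d = a * dsum f d.
Proof. by elim: d => [t|b d IH|d IHd e IHe] //=; rewrite ?IH ?IHd ?IHe ?mulrDr // mulrCA. Qed.

Definition coef (t : term) (d : dist) : C := dsum (fun s => ind (s = t)) d.

(** The Hermitian form for which pure terms are orthonormal, conjugate-linear in the first
    argument. *)
Definition ip (d e : dist) : C := dsum (fun t => (coef t d)^*) e.

Lemma ip_equiv d d' e e' : dequiv d d' -> dequiv e e' -> ip d e = ip d' e'.
Proof.
move=> hd he; rewrite /ip (dsum_equiv _ he); apply: eq_in_dsum => t _.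
by rewrite /coef (dsum_equiv _ hd).
Qed.

Lemma ip_DT s t : ip (DT s) (DT t) = ind (s = t).
Proof. by rewrite /ip /coef /= conj_ind. Qed.

Lemma ip_addl d1 d2 e : ip (DAdd d1 d2) e = ip d1 e + ip d2 e.
Proof.
by rewrite /ip -dsumD; apply: eq_in_dsum => t _; rewrite /coef /= rmorphD.
Qed.

Lemma ip_scall a d e : ip (DScal a d) e = a^* * ip d e.
Proof.
by rewrite /ip -dsumZ; apply: eq_in_dsum => t _; rewrite /coef /= rmorphM.
Qed.

Lemma ip_addr d e1 e2 : ip d (DAdd e1 e2) = ip d e1 + ip d e2.
Proof. by []. Qed.

Lemma ip_scalr a d e : ip d (DScal a e) = a * ip d e.
Proof. by []. Qed.

Lemma ip_conj d e : ip d e = (ip e d)^*.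
Proof.
elim: d => [t|a d IH|d IHd d' IHd'].
- elim: e => [s|a e IH|e IHe e' IHe'].
  + by rewrite !ip_DT conj_ind; apply: ind_iff; split=> ->.
  + by rewrite ip_scall ip_scalr rmorphM /= conjCK -IH.
  + by rewrite ip_addl ip_addr rmorphD /= -IHe -IHe'.
- by rewrite ip_scall ip_scalr rmorphM /= IH.
- by rewrite ip_addl ip_addr rmorphD /= IHd IHd'.
Qed.

(** Both sides are sesquilinear in [d] and [e], so comparing leaves is enough. The factor [k] makes
    the lemma nestable: for a map of several arguments it records the contribution of the other
    ones. *)
Lemma ip_dmap (k : C) (f g : term -> dist) d e :
  (forall s t, In s (leaves d) -> In t (leaves e) ->
     ip (f s) (g t) = k * ind (s = t)) ->
  ip (dmap f d) (dmap g e) = k * ip d e.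
Proof.
elim: d => [s|a d IH|d IHd d' IHd'] /= h.
- elim: e h => [t|a e IH|e IHe e' IHe'] h /=.
  + by rewrite ip_DT h //=; left.
  + by rewrite !ip_scalr IH // mulrCA.
  + rewrite !ip_addr mulrDr IHe ?IHe' //.
      by move=> s' t hs ht; apply: h => //; apply/in_app_iff; right.
    by move=> s' t hs ht; apply: h => //; apply/in_app_iff; left.
- by rewrite !ip_scall IH // mulrCA.
- rewrite !ip_addl mulrDr IHd ?IHd' // => s t hs ht; apply: h => //; apply/in_app_iff;
  by [left|right].
Qed.

End LinearExtension.

(** * Linear extension of maps, up to congruence *)

Lemma eq_in_dmap f g d :
  (forall t, In t (leaves d) -> f t = g t) -> dmap f d = dmap g d.
Proof.
elim: d => [t|a d IH|d IHd e IHe] /= h; first by apply: h; left.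
  by rewrite IH.
by rewrite IHd ?IHe // => t ht; apply: h; apply/in_app_iff; [right|left].
Qed.

Lemma dequiv_dmap f d e : dequiv d e -> dequiv (dmap f d) (dmap f e).
Proof. elim=> {d e} /=; eauto using dequiv. Qed.

Lemma dequiv_in_dmap f g d :
  (forall t, In t (leaves d) -> dequiv (f t) (g t)) -> dequiv (dmap f d) (dmap g d).
Proof.
elim: d => [t|a d IH|d IHd e IHe] /= h; first by apply: h; left.
  by apply: deq_scal; apply: IH.
by apply: deq_add; [apply: IHd|apply: IHe] => t ht; apply: h; apply/in_app_iff; [left|right].
Qed.

Lemma dequiv_addACA a b c d :
  dequiv (DAdd (DAdd a b) (DAdd c d)) (DAdd (DAdd a c) (DAdd b d)).
Proof.
apply: deq_trans (deq_assoc _ _ _) _; apply: deq_trans; last exact: deq_sym (deq_assoc _ _ _).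
apply: deq_add; first exact: deq_refl.
apply: deq_trans (deq_sym (deq_assoc _ _ _)) _; apply: deq_trans; last exact: deq_assoc.
apply: deq_add; [exact: deq_comm|exact: deq_refl].
Qed.

Lemma dmap_addf f g d :
  dequiv (dmap (fun t => DAdd (f t) (g t)) d) (DAdd (dmap f d) (dmap g d)).
Proof.
elim: d => [t|a d IH|d IHd e IHe] /=; first exact: deq_refl.
  by apply: deq_trans (deq_scal a IH) _; exact: deq_scalDr.
by apply: deq_trans (deq_add IHd IHe) _; exact: dequiv_addACA.
Qed.

Lemma dmap_scalf b f d : dequiv (dmap (fun t => DScal b (f t)) d) (DScal b (dmap f d)).
Proof.
elim: d => [t|a d IH|d IHd e IHe] /=; first exact: deq_refl.
  apply: deq_trans (deq_scal a IH) _; apply: deq_trans (deq_scalA _ _ _) _.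
  by rewrite mulrC; apply: deq_sym; exact: deq_scalA.
apply: deq_trans (deq_add IHd IHe) _; apply: deq_sym; exact: deq_scalDr.
Qed.

(** No axiom erases a term, not even one with coefficient 0, so the support is an invariant.
    Conditions on supports, such as consisting of values or of basis values, thus transfer along the
    congruence. *)
Lemma leaves_equiv d e : dequiv d e -> forall t, In t (leaves d) <-> In t (leaves e).
Proof.
elim=> {d e} //=.
- by move=> d e _ IH t; rewrite IH.
- by move=> d e f _ IH _ IH' t; rewrite IH.
- by move=> d d' e e' _ IH _ IH' t; rewrite !in_app_iff IH IH'.
- by move=> d e t; rewrite !in_app_iff or_comm.
- by move=> d e f t; rewrite !in_app_iff or_assoc.
- by move=> a b d t; rewrite in_app_iff; tauto.
Qed.

Lemma leaves_dmap f d t :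
  In t (leaves (dmap f d)) <-> exists2 s, In s (leaves d) & In t (leaves (f s)).
Proof.
elim: d => [s|a d IH|d IHd e IHe] //=.
  by split=> [h|[s' [<-|//]//]]; exists s => //; left.
rewrite in_app_iff IHd IHe; split.
  by move=> [] [s hs ht]; exists s => //; rewrite in_app_iff; [left|right].
by move=> [s /in_app_iff[hs|hs] ht]; [left|right]; exists s.
Qed.

Lemma leaves_lcomb h l t :
  In t (leaves (lcomb h l)) <-> exists2 p, In p (h :: l) & In t (leaves p.2).
Proof.
rewrite /lcomb; set d := DScal _ _.
have -> : (exists2 p, In p (h :: l) & In t (leaves p.2)) <->
    In t (leaves d) \/ exists2 p, In p l & In t (leaves p.2).
  split; first by move=> [p [<-|hp] ht]; [left|right; exists p].
  by move=> [ht|[p hp ht]]; [exists h => //; left|exists p => //; right].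
move: d; elim: l => [|p l IH] d /=; first by split=> [|[//|[p []]]]; left.
rewrite IH /= in_app_iff; split.
  by move=> [[]|[q hq ht]]; [left|right; exists p => //; left|right; exists q => //; right].
by move=> [|[q [<-|hq] ht]]; [left; left|left; right|right; exists q].
Qed.

Lemma dmap_lcomb f h l :
  dmap f (lcomb h l) = lcomb (h.1, dmap f h.2) (map (fun p => (p.1, dmap f p.2)) l).
Proof.
rewrite /lcomb /= -/(dmap f (DScal h.1 h.2)); move: (DScal h.1 h.2).
by elim: l => [|p l IH] d //=; rewrite IH.
Qed.

Lemma rcons_app (T : Type) (l : list T) x : rcons l x = (l ++ x :: nil)%list.
Proof. by rewrite -cats1. Qed.

Lemma lcomb_rcons h l p : lcomb h (l ++ p :: nil) = DAdd (lcomb h l) (DScal p.1 p.2).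
Proof. by rewrite /lcomb fold_left_app. Qed.

(** Exchange of sums in a bilinear substitution: it turns the combination of substituted bodies in
    the clause for [TDarr] into the linear extension of one map on values. *)
Lemma dmap_lcombf h l (F : dist -> term -> dist) d :
  dequiv (dmap (fun v => lcomb (h.1, F h.2 v) (map (fun p => (p.1, F p.2 v)) l)) d)
         (lcomb (h.1, dmap (F h.2) d) (map (fun p : C * dist => (p.1, dmap (F p.2) d)) l)).
Proof.
elim/last_ind: l => [|l p IH]; first by rewrite /lcomb /=; exact: dmap_scalf.
rewrite rcons_app map_app lcomb_rcons.
have -> : (fun v => lcomb (h.1, F h.2 v) (map (fun p => (p.1, F p.2 v)) (l ++ p :: nil))) =
    fun v => DAdd (lcomb (h.1, F h.2 v) (map (fun p => (p.1, F p.2 v)) l))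
                  (DScal p.1 (F p.2 v)).
  by apply: funext => v; rewrite map_app lcomb_rcons.
apply: deq_trans (dmap_addf _ _ _) _; apply: deq_add => //; exact: dmap_scalf.
Qed.

(** * The unit sphere *)

Section Sphere.
Local Open Scope ring_scope.

Definition tcomb (h : C * term) (l : list (C * term)) : dist :=
  lcomb (h.1, DT h.2) (map (fun p => (p.1, DT p.2)) l).

Lemma dsum_lcomb f h l :
  dsum f (lcomb h l) = \sum_(p <- h :: l) p.1 * dsum f p.2.
Proof.
rewrite big_cons /lcomb -/(dsum f (DScal h.1 h.2)); move: (DScal h.1 h.2).
elim: l => [|p l IH] d /=; first by rewrite big_nil addr0.
by rewrite IH big_cons /= addrA.
Qed.

Lemma dsum_tcomb f h l :
  dsum f (tcomb h l) = \sum_(p <- h :: l) p.1 * f p.2.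
Proof. by rewrite dsum_lcomb !big_cons -[map _ l]/(seq.map _ l) big_map. Qed.

Lemma sum_ind_NoDup (L : list (C * term)) p :
  NoDup (map snd L) -> In p L -> \sum_(q <- L) q.1 * ind (q.2 = p.2) = p.1.
Proof.
elim: L => //= q L IH /NoDup_cons_iff[hq hL] [<-|hp]; rewrite big_cons.
  suff -> : \sum_(r <- L) r.1 * ind (r.2 = q.2) = 0 by rewrite ind_true // mulr1 addr0.
  elim: L hq {IH hL} => [|r L IH] hq; first by rewrite big_nil.
  rewrite big_cons IH => [|h]; last by apply: hq; right.
  by rewrite ind_false ?mulr0 ?add0r // => e; apply: hq; left.
rewrite IH // ind_false ?mulr0 ?add0r // => e; apply: hq; rewrite e.
exact: in_map.
Qed.

Lemma ip_tcomb_NoDup h l : NoDup (map snd (h :: l)) ->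
  ip (tcomb h l) (tcomb h l) = \sum_(p <- h :: l) `|p.1| ^+ 2.
Proof.
move=> hn; rewrite /ip dsum_tcomb.
have {}hn p : In p (h :: l) -> coef p.2 (tcomb h l) = p.1.
  by move=> hp; rewrite /coef dsum_tcomb sum_ind_NoDup.
elim: (h :: l) hn => [|p L IH] hn; first by rewrite !big_nil.
rewrite !big_cons IH => [|q hq]; last by apply: hn; right.
by rewrite hn ?normCK //; left.
Qed.

(* Coefficients of the same term are merged, as [sphere] needs pairwise distinct terms. *)
Lemma tcomb_insert h l p : NoDup (map snd (h :: l)) ->
  exists h' l', [/\ NoDup (map snd (h' :: l')),
    dequiv (DAdd (DScal p.1 (DT p.2)) (tcomb h l)) (tcomb h' l') &
    forall t, In t (map snd (h' :: l')) <-> t = p.2 \/ In t (map snd (h :: l))].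
Proof.
elim/last_ind: l => [|l q IH] hn.
  case: (pselect (p.2 = h.2)) => e.
    exists (p.1 + h.1, h.2), nil; split=> //.
      by rewrite e /tcomb /lcomb /=; apply: deq_sym; exact: deq_scalDl.
    by move=> t /=; rewrite e; split; [right|case=> [->|//]; left].
  exists p, (h :: nil); split=> //=.
  - by constructor=> //=; case=> // /esym.
  - by rewrite /tcomb /lcomb /=; exact: deq_refl.
  - by move=> t; split=> [[->|]|[->|]]; auto.
have {}hn : NoDup (map snd (h :: l)) /\ ~ In q.2 (map snd (h :: l)).
  move: hn; rewrite rcons_app app_comm_cons map_app /= => hn.
  by have := NoDup_remove (map snd (h :: l)) nil q.2 hn; rewrite app_nil_r.
have tq h' l' : tcomb h' (rcons l' q) = DAdd (tcomb h' l') (DScal q.1 (DT q.2)).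
  by rewrite /tcomb rcons_app map_app lcomb_rcons.
have inq h' (l' : list (C * term)) t :
    In t (map snd (h' :: rcons l' q)) <-> In t (map snd (h' :: l')) \/ t = q.2.
  by rewrite rcons_app app_comm_cons map_app in_app_iff /=; intuition.
case: hn => hn hq.
have nd h' (l' : list (C * term)) : NoDup (map snd (h' :: l')) ->
    ~ In q.2 (map snd (h' :: l')) -> NoDup (map snd (h' :: rcons l' q)).
  move=> hn' hq'; rewrite rcons_app app_comm_cons map_app.
  by apply: Permutation_NoDup (Permutation_cons_append _ _) _; constructor.
case: (pselect (p.2 = q.2)) => e.
  exists h, (rcons l (p.1 + q.1, q.2)); split.
  - rewrite rcons_app app_comm_cons map_app.
    by apply: Permutation_NoDup (Permutation_cons_append _ _) _; constructor.
  - rewrite tq e /tcomb rcons_app map_app lcomb_rcons /=.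
    apply: deq_trans (deq_comm _ _) _; apply: deq_trans (deq_assoc _ _ _) _.
    apply: deq_add; first exact: deq_refl.
    by rewrite addrC; apply: deq_sym; exact: deq_scalDl.
  - move=> t; rewrite inq rcons_app app_comm_cons map_app in_app_iff e /=.
    by intuition.
have [h' [l' [hn' he hi]]] := IH hn.
exists h', (rcons l' q); split.
- by apply: nd => // /hi [] // /esym.
- rewrite !tq; apply: deq_trans (deq_sym (deq_assoc _ _ _)) _.
  by apply: deq_add => //; exact: deq_refl.
- by move=> t; rewrite !inq hi or_assoc.
Qed.

Lemma dequiv_tcomb d : exists h l, dequiv d (tcomb h l) /\ NoDup (map snd (h :: l)).
Proof.
elim: d => [t|a d [h [l [hd hn]]]|d [h [l [hd hn]]] e [h' [l' [he hn']]]].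
- exists (1, t), nil; split; last by constructor=> //; constructor.
  by apply: deq_sym; exact: deq_one.
- exists (a * h.1, h.2), (map (fun p => (a * p.1, p.2)) l); split; last first.
    by rewrite /= map_map.
  apply: deq_trans (deq_scal a hd) _; rewrite /tcomb map_map /= {hd hn}.
  elim/last_ind: l => [|l p IH]; first by rewrite /lcomb /=; exact: deq_scalA.
  rewrite rcons_app !map_app !lcomb_rcons; apply: deq_trans (deq_scalDr _ _ _) _.
  by apply: deq_add IH _; exact: deq_scalA.
- suff [h2 [l2 [H1 H2]]] : exists h2 l2,
      dequiv (DAdd (tcomb h l) (tcomb h' l')) (tcomb h2 l2) /\ NoDup (map snd (h2 :: l2)).
    by exists h2, l2; split=> //; apply: deq_trans (deq_add hd he) _.
  clear hd he hn d e; elim/last_ind: l => [|l p [h2 [l2 [H1 H2]]]].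
    by have [h2 [l2 [? ? _]]] := tcomb_insert h hn'; exists h2, l2.
  have [h3 [l3 [H3 H4 _]]] := tcomb_insert p H2; exists h3, l3; split=> //.
  rewrite /tcomb rcons_app map_app lcomb_rcons.
  apply: deq_trans (deq_add (deq_comm _ _) (deq_refl _)) _.
  apply: deq_trans (deq_assoc _ _ _) _; apply: deq_trans H4.
  by apply: deq_add => //; exact: deq_refl.
Qed.

(** [sphere] asks for some representation with pairwise distinct terms; there [ip] is the sum of
    squared moduli, and [ip] does not depend on the representation. *)
Lemma sphereP d : sphere d <-> ip d d = 1.
Proof.
split=> [[h [l [hn [hd hs]]]]|hs].
  by rewrite (ip_equiv hd hd) -/(tcomb h l) ip_tcomb_NoDup.
have [h [l [hd hn]]] := dequiv_tcomb d; exists h, l; split=> //; split=> //.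
by rewrite -ip_tcomb_NoDup // -(ip_equiv hd hd).
Qed.

Lemma ip_lcomb h l h' l' : ip (lcomb h l) (lcomb h' l') =
  \sum_(p <- h :: l) \sum_(q <- h' :: l') p.1^* * q.1 * ip p.2 q.2.
Proof.
rewrite exchange_big /= /ip dsum_lcomb; apply: eq_bigr => q _.
rewrite -/(ip _ _) ip_conj {1}/ip dsum_lcomb rmorph_sum mulr_sumr; apply: eq_bigr => p _.
by rewrite rmorphM /= -/(ip _ _) -ip_conj mulrCA mulrA.
Qed.

End Sphere.

(** * Evaluation *)

Definition vals (d : dist) : Prop := forall t, In t (leaves d) -> is_val t.

(** * Determinism and uniqueness of results *)

Lemma red1_not_val t e : red1 t e -> ~ is_val t.
Proof. by elim=> //= *; tauto. Qed.

(** The value premises fix the order (argument before function, right component before left) and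
    values do not reduce, so the rules never overlap. *)
Lemma red1_det t e : red1 t e -> forall e', red1 t e' -> e = e'.
Proof.
elim=> {t e}; intros; match goal with H : red1 _ ?e |- _ = ?e => inversion H end; subst=> //;
  try (exfalso; match goal with
    | H : red1 _ _ |- _ => apply: (red1_not_val H) => /=; tauto end);
  by match goal with IH : forall e, red1 ?t e -> _ = e, H : red1 ?t _ |- _ =>
    rewrite (IH _ H) end.
Qed.

(** [evals] reduces one leaf at a time and may use the congruence in between, hence split a leaf
    into copies that evolve separately. This big-step relation evaluates all leaves without the
    congruence, which makes it a partial function; comparing it with [evals] isolates the effect of
    the congruence. *)
Inductive nf : term -> dist -> Prop :=
| nf_val v : is_val v -> nf v (DT v)
| nf_red t e w : red1 t e -> nfD e w -> nf t w
with nfD : dist -> dist -> Prop :=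
| nfD_DT t w : nf t w -> nfD (DT t) w
| nfD_scal a d w : nfD d w -> nfD (DScal a d) (DScal a w)
| nfD_add d e w w' : nfD d w -> nfD e w' -> nfD (DAdd d e) (DAdd w w').

Scheme nf_mut := Minimality for nf Sort Prop
  with nfD_mut := Minimality for nfD Sort Prop.

Lemma nfD_det d w : nfD d w -> forall w', nfD d w' -> w = w'.
Proof.
move: d w; apply: (@nfD_mut (fun t w => forall w', nf t w' -> w = w')).
- move=> v hv w' h; inversion h; subst => //; exfalso.
  by apply: red1_not_val hv; eassumption.
- move=> t e w r _ IH w' h; inversion h; subst.
    by exfalso; apply: red1_not_val r _.
  by apply: IH; rewrite (red1_det r H).
- by move=> t w _ IH w' h; inversion h; subst; apply: IH.
- by move=> a d w _ IH w' h; inversion h; subst; rewrite (IH w0).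
- by move=> d e w1 w2 _ IH1 _ IH2 w' h; inversion h; subst; rewrite (IH1 w) ?(IH2 w'0).
Qed.

(** Both directions are stated together so that symmetry only exchanges them. Each axiom is matched
    by the same axiom on results; merging two copies of a distribution is the case that requires
    determinism. *)
Lemma nfD_equiv d e : dequiv d e ->
  (forall w, nfD d w -> exists2 w', nfD e w' & dequiv w w') /\
  (forall w, nfD e w -> exists2 w', nfD d w' & dequiv w w').
Proof.
have inv_scal a d' w : nfD (DScal a d') w -> exists2 w', nfD d' w' & w = DScal a w'.
  by move=> h; inversion h; subst; exists w0.
have inv_add d' e' w : nfD (DAdd d' e') w ->
    exists w1 w2, [/\ nfD d' w1, nfD e' w2 & w = DAdd w1 w2].
  by move=> h; inversion h; subst; exists w0, w'.
elim=> {d e}.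
- by move=> d; split=> w h; exists w => //; exact: deq_refl.
- by move=> d e _ [].
- move=> d e f _ [h1 h2] _ [h3 h4]; split=> w.
    by move=> /h1[w1 /h3[w2 ? ?] ?]; exists w2 => //; apply: deq_trans; eassumption.
  by move=> /h4[w1 /h2[w2 ? ?] ?]; exists w2 => //; apply: deq_trans; eassumption.
- move=> d d' e e' _ [h1 h2] _ [h3 h4]; split=> w /inv_add[w1 [w2 [H1 H2 ->]]].
    have [w3 ? ?] := h1 _ H1; have [w4 ? ?] := h3 _ H2.
    by exists (DAdd w3 w4); [apply: nfD_add|apply: deq_add].
  have [w3 ? ?] := h2 _ H1; have [w4 ? ?] := h4 _ H2.
  by exists (DAdd w3 w4); [apply: nfD_add|apply: deq_add].
- move=> a d d' _ [h1 h2]; split=> w /inv_scal[w1 H1 ->].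
    by have [w3 ? ?] := h1 _ H1; exists (DScal a w3); [apply: nfD_scal|apply: deq_scal].
  by have [w3 ? ?] := h2 _ H1; exists (DScal a w3); [apply: nfD_scal|apply: deq_scal].
- by move=> d e; split=> w /inv_add[w1 [w2 [H1 H2 ->]]]; exists (DAdd w2 w1);
    [apply: nfD_add|exact: deq_comm|apply: nfD_add|exact: deq_comm].
- move=> d e f; split=> w.
    move=> /inv_add[w1 [w2 [/inv_add[w3 [w4 [H1 H2 ->]]] H3 ->]]].
    by exists (DAdd w3 (DAdd w4 w2)); [do ?apply: nfD_add|exact: deq_assoc].
  move=> /inv_add[w1 [w2 [H3 /inv_add[w3 [w4 [H1 H2 ->]]] ->]]].
  by exists (DAdd (DAdd w1 w3) w4); [do ?apply: nfD_add|exact: deq_sym (deq_assoc _ _ _)].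
- move=> d; split=> w; first by move=> /inv_scal[w1 H1 ->]; exists w1 => //; exact: deq_one.
  by move=> h; exists (DScal 1%R w); [apply: nfD_scal|exact: deq_sym (deq_one _)].
- move=> a b d; split=> w.
    move=> /inv_scal[w1 /inv_scal[w2 H2 ->] ->].
    by exists (DScal (a * b)%R w2); [apply: nfD_scal|exact: deq_scalA].
  move=> /inv_scal[w1 H ->]; exists (DScal a (DScal b w1)); first by do ?apply: nfD_scal.
  exact: deq_sym (deq_scalA _ _ _).
- move=> a b d; split=> w.
    move=> /inv_scal[w1 H ->]; exists (DAdd (DScal a w1) (DScal b w1)).
      by apply: nfD_add; apply: nfD_scal.
    exact: deq_scalDl.
  move=> /inv_add[w1 [w2 [/inv_scal[w3 H3 ->] /inv_scal[w4 H4 ->] ->]]].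
  (* The two copies of [d] were evaluated independently; determinism makes their results equal, so
     they can be merged. *)
  rewrite (nfD_det H3 H4); exists (DScal (a + b)%R w4); first exact: nfD_scal.
  exact: deq_sym (deq_scalDl _ _ _).
- move=> a d e; split=> w.
    move=> /inv_scal[w1 /inv_add[w2 [w3 [H2 H3 ->]]] ->].
    exists (DAdd (DScal a w2) (DScal a w3)); first by apply: nfD_add; apply: nfD_scal.
    exact: deq_scalDr.
  move=> /inv_add[w1 [w2 [/inv_scal[w3 H3 ->] /inv_scal[w4 H4 ->] ->]]].
  exists (DScal a (DAdd w3 w4)); first by apply: nfD_scal; apply: nfD_add.
  exact: deq_sym (deq_scalDr _ _ _).
Qed.

Lemma nfD_vals w : vals w -> nfD w w.
Proof.
elim: w => [t|a d IH|d IHd e IHe] /= h.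
- by constructor; constructor; apply: h; left.
- by constructor; apply: IH.
- by constructor; [apply: IHd|apply: IHe] => t ht; apply: h; apply/in_app_iff; [left|right].
Qed.

Lemma nfD_dstep d e : dstep d e -> forall w, nfD e w -> nfD d w.
Proof.
elim=> {d e}.
- by move=> t e r w h; constructor; apply: nf_red r h.
- by move=> a d e _ IH w h; inversion h; subst; constructor; apply: IH.
- by move=> d e d' _ IH w h; inversion h; subst; constructor=> //; apply: IH.
- by move=> d e d' _ IH w h; inversion h; subst; constructor=> //; apply: IH.
Qed.

(** Backwards along the evaluation: values are their own result, a step leaves the result unchanged,
    and a congruence changes it at most up to congruence. *)
Lemma evals_nfD d w : evals d w -> vals w -> exists2 w', nfD d w' & dequiv w w'.
Proof.
elim=> {d w} [d e h hv|d d' e' f h hs _ IH /IH[w hw hfw]].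
  by have [_ /(_ e (nfD_vals hv))] := nfD_equiv h.
have [_ /(_ w (nfD_dstep hs hw))[w' h1 h2]] := nfD_equiv h.
by exists w' => //; apply: deq_trans hfw h2.
Qed.

Lemma evals_unique d w w' : evals d w -> evals d w' -> vals w -> vals w' -> dequiv w w'.
Proof.
move=> h h' /(evals_nfD h)[u hu eu] /(evals_nfD h')[u' hu' eu'].
by rewrite (nfD_det hu' hu) in eu'; apply: deq_trans eu (deq_sym eu').
Qed.

(** * Composition of evaluations and evaluation contexts *)

Lemma evals_equiv d e : dequiv d e -> evals d e.
Proof. exact: ev_refl. Qed.

Lemma evals_refl d : evals d d.
Proof. exact: evals_equiv (deq_refl d). Qed.

Lemma evals_trans e d f : evals d e -> evals e f -> evals d f.
Proof.
elim=> {d e} [d e h|d d' e' e h hs _ IH /IH]; last exact: ev_step h hs.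
move=> h2; case: h2 h => {e f} [e f h' h|e e1 e2 f h1 h2 h3 h]; first by
  apply: ev_refl; apply: deq_trans h h'.
by apply: ev_step h2 h3; apply: deq_trans h h1.
Qed.

Lemma evals_red1 t e : red1 t e -> evals (DT t) e.
Proof. by move=> r; apply: ev_step (deq_refl _) (ds_term r) (evals_refl _). Qed.

Lemma evals_scal a d e : evals d e -> evals (DScal a d) (DScal a e).
Proof.
elim=> {d e} [d e h|d d' e' e h hs _ IH]; first by apply: ev_refl; apply: deq_scal.
by apply: ev_step IH; [apply: deq_scal h|apply: ds_scal].
Qed.

Lemma evals_add d e d' e' : evals d e -> evals d' e' -> evals (DAdd d d') (DAdd e e').
Proof.
move=> h h'; apply: (@evals_trans (DAdd e d')).
  elim: h {h'} => {d e} [d e h|d d1 e1 e h hs _ IH].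
    by apply: ev_refl; apply: deq_add h (deq_refl _).
  by apply: ev_step IH; [apply: deq_add h (deq_refl _)|apply: ds_addL].
elim: h' {h} => {d' e'} [d' e' h|d' d1 e1 e' h hs _ IH].
  by apply: ev_refl; apply: deq_add (deq_refl _) h.
by apply: ev_step IH; [apply: deq_add (deq_refl _) h|apply: ds_addR].
Qed.

Lemma evals_dmap f g d :
  (forall t, In t (leaves d) -> evals (f t) (g t)) -> evals (dmap f d) (dmap g d).
Proof.
elim: d => [t|a d IH|d IHd e IHe] /= h; first by apply: h; left.
  by apply: evals_scal; apply: IH.
by apply: evals_add; [apply: IHd|apply: IHe] => t ht; apply: h; apply/in_app_iff; [left|right].
Qed.

(** Evaluation contexts, described by their reduction rule instead of a grammar. *)
Definition frame (K : term -> term) : Prop :=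
  forall t e, red1 t e -> red1 (K t) (dmap (fun t' => DT (K t')) e).

Lemma frame_appR s : frame (App s). Proof. by move=> t e; exact: r_appR. Qed.
Lemma frame_appL v : is_val v -> frame (App^~ v). Proof. by move=> hv t e; exact: r_appL. Qed.
Lemma frame_pairR s : frame (Pair s). Proof. by move=> t e; exact: r_pairR. Qed.
Lemma frame_pairL v : is_val v -> frame (Pair^~ v). Proof. by move=> hv t e; exact: r_pairL. Qed.
Lemma frame_let d : frame (Let^~ d). Proof. by move=> t e; exact: r_letC. Qed.
Lemma frame_match d1 d2 : frame (fun t => Match t d1 d2).
Proof. by move=> t e; exact: r_matchC. Qed.

Lemma evals_frame K d e : frame K -> evals d e ->
  evals (dmap (fun t => DT (K t)) d) (dmap (fun t => DT (K t)) e).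
Proof.
move=> hK; elim=> {d e} [d e h|d d' e' f h hs _ IH].
  by apply: ev_refl; apply: dequiv_dmap.
apply: ev_step IH; first by apply: dequiv_dmap h.
elim: hs {h} => {d d' e' f} /= *; try by constructor.
by apply: ds_term; apply: hK.
Qed.

(* [NF d] is junk unless [d] evaluates to a distribution of values. *)
Definition NF (d : dist) : dist :=
  if pselect (exists w, evals d w /\ vals w) is left h then projT1 (cid h) else d.

Lemma NF_unique d w : evals d w -> vals w -> dequiv (NF d) w.
Proof.
rewrite /NF => h hv; case: pselect => [h'|[]]; last by exists w.
by case: (cid h') => w' [hw' hv'] /=; apply: evals_unique hw' h hv' hv.
Qed.

Lemma evals_NF d w : evals d w -> vals w -> evals d (NF d).
Proof.
by move=> h hv; apply: (evals_trans h); apply: evals_equiv (deq_sym (NF_unique h hv)).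
Qed.

(** * Substitution *)

Definition vnth (vs : list term) (n : nat) : term := List.nth n vs Unit.

(* Indices beyond the length of [vs] become [Unit], so that the result has no
   free index from [k] on when the values [vs] are closed. *)
Fixpoint instT (k : nat) (vs : list term) (t : term) : term :=
  match t with
  | Var n => if n < k then Var n else vnth vs (n - k)
  | Lam d => Lam (instD k.+1 vs d)
  | Unit => Unit
  | Pair s u => Pair (instT k vs s) (instT k vs u)
  | Inl s => Inl (instT k vs s)
  | Inr s => Inr (instT k vs s)
  | App s u => App (instT k vs s) (instT k vs u)
  | Seq s d => Seq (instT k vs s) (instD k vs d)
  | Let s d => Let (instT k vs s) (instD k.+2 vs d)
  | Match s d1 d2 => Match (instT k vs s) (instD k.+1 vs d1) (instD k.+1 vs d2)
  end
with instD (k : nat) (vs : list term) (d : dist) : dist :=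
  match d with
  | DT t => DT (instT k vs t)
  | DScal a d => DScal a (instD k vs d)
  | DAdd d e => DAdd (instD k vs d) (instD k vs e)
  end.

Definition cvals (vs : list term) : Prop := forall v, In v vs -> closedT v /\ is_val v.

Lemma cvals_vnth vs n : cvals vs -> closedT (vnth vs n) /\ is_val (vnth vs n).
Proof.
move=> h; rewrite /vnth.
by have [|->] := nth_in_or_default n vs Unit; first exact: h.
Qed.

Lemma cvals_cons v vs : closedT v -> is_val v -> cvals vs -> cvals (v :: vs).
Proof. by move=> h1 h2 h u [<-|/h]. Qed.

Lemma subst_id :
  (forall t k w, (forall n, k <= n -> occT n t = false) -> substT k w t = t) /\
  (forall d k w, (forall n, k <= n -> occD n d = false) -> substD k w d = d).
Proof.
apply: term_dist_ind => /=.
- by move=> n k w h; case: ltnP => // hk; move: (h n hk); rewrite eqxx.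
- by move=> d IH k w h; rewrite IH // => -[|n] // hn; apply: h.
- by [].
- by move=> s IHs t IHt k w h; rewrite IHs ?IHt // => n /h /norP[/negbTE ? /negbTE ?].
- by move=> s IH k w h; rewrite IH.
- by move=> s IH k w h; rewrite IH.
- by move=> s IHs t IHt k w h; rewrite IHs ?IHt // => n /h /norP[/negbTE ? /negbTE ?].
- by move=> s IHs t IHt k w h; rewrite IHs ?IHt // => n /h /norP[/negbTE ? /negbTE ?].
- move=> s IHs d IHd k w h; rewrite IHs => [|n /h /norP[/negbTE ?]//].
  by rewrite IHd // => -[|[|n]] // hn; have /norP[_ /negbTE] := h n hn.
- move=> s IHs d1 IH1 d2 IH2 k w h; rewrite IHs => [|n /h /norP[/negbTE ?]//].
  by rewrite IH1 ?IH2 // => -[|n] // hn; have /norP[_ /norP[/negbTE ? /negbTE ?]] := h n hn.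
- by move=> t IH k w h; rewrite IH.
- by move=> a d IH k w h; rewrite IH.
- by move=> s IHs t IHt k w h; rewrite IHs ?IHt // => n /h /norP[/negbTE ? /negbTE ?].
Qed.

Lemma substT_closed t k w : closedT t -> substT k w t = t.
Proof. by move=> h; apply: (proj1 subst_id). Qed.

Lemma inst_id :
  (forall t k vs, (forall n, k <= n -> occT n t = false) -> instT k vs t = t) /\
  (forall d k vs, (forall n, k <= n -> occD n d = false) -> instD k vs d = d).
Proof.
apply: term_dist_ind => /=.
- by move=> n k w h; case: ltnP => // hk; move: (h n hk); rewrite eqxx.
- by move=> d IH k w h; rewrite IH // => -[|n] // hn; apply: h.
- by [].
- by move=> s IHs t IHt k w h; rewrite IHs ?IHt // => n /h /norP[/negbTE ? /negbTE ?].
- by move=> s IH k w h; rewrite IH.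
- by move=> s IH k w h; rewrite IH.
- by move=> s IHs t IHt k w h; rewrite IHs ?IHt // => n /h /norP[/negbTE ? /negbTE ?].
- by move=> s IHs t IHt k w h; rewrite IHs ?IHt // => n /h /norP[/negbTE ? /negbTE ?].
- move=> s IHs d IHd k w h; rewrite IHs => [|n /h /norP[/negbTE ?]//].
  by rewrite IHd // => -[|[|n]] // hn; have /norP[_ /negbTE] := h n hn.
- move=> s IHs d1 IH1 d2 IH2 k w h; rewrite IHs => [|n /h /norP[/negbTE ?]//].
  by rewrite IH1 ?IH2 // => -[|n] // hn; have /norP[_ /norP[/negbTE ? /negbTE ?]] := h n hn.
- by move=> t IH k w h; rewrite IH.
- by move=> a d IH k w h; rewrite IH.
- by move=> s IHs t IHt k w h; rewrite IHs ?IHt // => n /h /norP[/negbTE ? /negbTE ?].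
Qed.

Lemma instT_closed t k vs : closedT t -> instT k vs t = t.
Proof. by move=> h; apply: (proj1 inst_id). Qed.

Lemma inst_ext :
  (forall t k vs vs', (forall n, occT (k + n) t -> vnth vs n = vnth vs' n) ->
     instT k vs t = instT k vs' t) /\
  (forall d k vs vs', (forall n, occD (k + n) d -> vnth vs n = vnth vs' n) ->
     instD k vs d = instD k vs' d).
Proof.
apply: term_dist_ind => /=.
- by move=> n k vs vs' h; case: ltnP => // hk; apply: h; rewrite subnKC.
- by move=> d IH k vs vs' h; rewrite (IH _ _ vs').
- by [].
- by move=> s IHs t IHt k vs vs' h; rewrite (IHs _ _ vs') ?(IHt _ _ vs') // => n hn;
    apply: h; rewrite hn ?orbT.
- by move=> s IH k vs vs' h; rewrite (IH _ _ vs').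
- by move=> s IH k vs vs' h; rewrite (IH _ _ vs').
- by move=> s IHs t IHt k vs vs' h; rewrite (IHs _ _ vs') ?(IHt _ _ vs') // => n hn;
    apply: h; rewrite hn ?orbT.
- by move=> s IHs t IHt k vs vs' h; rewrite (IHs _ _ vs') ?(IHt _ _ vs') // => n hn;
    apply: h; rewrite hn ?orbT.
- by move=> s IHs t IHt k vs vs' h; rewrite (IHs _ _ vs') ?(IHt _ _ vs') // => n hn;
    apply: h; rewrite hn ?orbT.
- by move=> s IHs d1 IH1 d2 IH2 k vs vs' h;
    rewrite (IHs _ _ vs') ?(IH1 _ _ vs') ?(IH2 _ _ vs') // => n hn;
    apply: h; rewrite hn ?orbT.
- by move=> t IH k vs vs' h; rewrite (IH _ _ vs').
- by move=> a d IH k vs vs' h; rewrite (IH _ _ vs').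
- by move=> s IHs t IHt k vs vs' h; rewrite (IHs _ _ vs') ?(IHt _ _ vs') // => n hn;
    apply: h; rewrite hn ?orbT.
Qed.

Lemma occ_inst vs : cvals vs ->
  (forall t k n, occT n (instT k vs t) = (n < k) && occT n t) /\
  (forall d k n, occD n (instD k vs d) = (n < k) && occD n d).
Proof.
move=> hvs; apply: term_dist_ind => /=; try by move=> *; rewrite ?andbF //; eauto.
- move=> m k n; case: ltnP => hm /=.
    by case: eqVneq => [<-|]; rewrite ?hm ?andbF.
  rewrite (proj1 (cvals_vnth (m - k) hvs)); case: eqVneq => [<-|]; last by rewrite andbF.
  by rewrite ltnNge hm.
- by move=> s IHs t IHt k n; rewrite IHs IHt andb_orr.
- by move=> s IHs t IHt k n; rewrite IHs IHt andb_orr.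
- by move=> s IHs t IHt k n; rewrite IHs IHt andb_orr.
- by move=> s IHs t IHt k n; rewrite IHs IHt andb_orr.
- by move=> s IHs d1 IH1 d2 IH2 k n; rewrite IHs IH1 IH2 !andb_orr.
- by move=> s IHs t IHt k n; rewrite IHs IHt andb_orr.
Qed.

Lemma closed_instT vs t : cvals vs -> closedT (instT 0 vs t).
Proof. by move=> h n; rewrite (proj1 (occ_inst h)). Qed.

(** Instantiation below a binder leaves index [k] free; filling it with [v] amounts to a longer list
    of values. This is the effect of a beta step on an instantiated abstraction. *)
Lemma subst_inst vs v : cvals vs ->
  (forall t k, substT k v (instT k.+1 vs t) = instT k (v :: vs) t) /\
  (forall d k, substD k v (instD k.+1 vs d) = instD k (v :: vs) d).
Proof.
move=> hvs; apply: term_dist_ind => /=; try by move=> *; congruence.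
move=> n k; rewrite ltnS; case: (ltngtP n k) => hn /=.
- by rewrite hn.
- rewrite substT_closed; last by case: (cvals_vnth (n - k.+1) hvs).
  by rewrite /vnth (_ : n - k = (n - k.+1).+1) //; lia.
- by rewrite hn ltnn eqxx subnn.
Qed.

(** [substT] lowers the later indices by one, exactly as prepending [v] shifts the list. *)
Lemma inst_subst vs v : closedT v ->
  (forall t k, instT k vs (substT k v t) = instT k (v :: vs) t) /\
  (forall d k, instD k vs (substD k v d) = instD k (v :: vs) d).
Proof.
move=> hv; apply: term_dist_ind => /=; try by move=> *; congruence.
move=> n k; case: (ltngtP n k) => hn /=.
- by rewrite hn.
- rewrite (_ : n.-1 < k = false); last by lia.
  by rewrite /vnth (_ : n - k = (n.-1 - k).+1) //; lia.
- by rewrite hn subnn instT_closed.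
Qed.

Lemma occ_subst v : closedT v ->
  (forall t k n, occT n (substT k v t) -> occT (if n < k then n else n.+1) t) /\
  (forall d k n, occD n (substD k v d) -> occD (if n < k then n else n.+1) d).
Proof.
move=> hv; apply: term_dist_ind => //=.
- move=> m k n; case: (ltngtP m k) => hm /=.
  + by move=> /eqP <-; rewrite hm eqxx.
  + by move=> /eqP <-; case: ltnP => h; lia.
  + by rewrite hv.
- by move=> d IH k n /IH; rewrite ltnS; case: ifP.
- by move=> s IHs t IHt k n /orP[/IHs->|/IHt->]; rewrite ?orbT.
- by move=> s IHs t IHt k n /orP[/IHs->|/IHt->]; rewrite ?orbT.
- by move=> s IHs t IHt k n /orP[/IHs->|/IHt->]; rewrite ?orbT.
- move=> s IHs d IH k n /orP[/IHs->//|/IH]; rewrite !ltnS.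
  by case: ifP => _ ->; rewrite orbT.
- move=> s IHs d1 IH1 d2 IH2 k n /or3P[/IHs->//|/IH1|/IH2]; rewrite !ltnS;
  by case: ifP => _ ->; rewrite ?orbT.
- by move=> s IHs t IHt k n /orP[/IHs->|/IHt->]; rewrite ?orbT.
Qed.

(** [close] consumes index 0 repeatedly, which for closed values agrees with substituting all at
    once. The bound on indices rules out variables that [close] would leave free and [instT] would
    send to [Unit]. *)
Lemma close_DT vs t : cvals vs -> (forall n, occT n t -> n < length vs) ->
  close (DT t) (map DT vs) = DT (instT 0 vs t).
Proof.
elim: vs t => [|v vs IH] t hvs ht /=.
  by rewrite instT_closed // => n; case e: (occT n t) => //; have := ht n e.
have [hv _] : closedT v /\ is_val v by apply: hvs; left.
rewrite /close /= -/(close _ _) IH.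
- by rewrite (proj1 (inst_subst vs hv)).
- by move=> u hu; apply: hvs; right.
- by move=> n /(proj1 (occ_subst hv)) /= /ht.
Qed.

(** Multilinear expansion: the sum of [F vs], weighted by products of coefficients, over all ways of
    picking one leaf from each entry of [ws]. *)
Fixpoint mexp (ws : list dist) (F : list term -> dist) : dist :=
  match ws with
  | nil => F nil
  | w :: ws => dmap (fun v => mexp ws (fun vs => F (v :: vs))) w
  end.

Definition selects (vs : list term) (ws : list dist) : Prop :=
  Forall2 (fun v w => In v (leaves w)) vs ws.

Lemma lsubst_equiv d d' w : dequiv d d' -> dequiv (lsubst d w) (lsubst d' w).
Proof.
move=> h; apply: dequiv_in_dmap => v _.
have E d1 : substD 0 v d1 = dmap (fun t => DT (substT 0 v t)) d1.
  by elim: d1 => [t|a d1 IH|d1 IH1 d2 IH2] //=; rewrite ?IH ?IH1 ?IH2.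
by rewrite !E; apply: dequiv_dmap.
Qed.

Lemma lsubst_dmap f w u : dequiv (lsubst (dmap f w) u) (dmap (fun v => lsubst (f v) u) w).
Proof.
rewrite /lsubst; elim: w => [t|a d IH|d IHd e IHe] /=; first exact: deq_refl.
  by apply: deq_trans (dmap_scalf _ _ _) _; apply: deq_scal.
by apply: deq_trans (dmap_addf _ _ _) _; apply: deq_add.
Qed.

Lemma close_equiv d d' ws : dequiv d d' -> dequiv (close d ws) (close d' ws).
Proof. by elim: ws d d' => [|w ws IH] d d' h //=; apply: IH; apply: lsubst_equiv. Qed.

Lemma close_dmap f w ws :
  dequiv (close (dmap f w) ws) (dmap (fun v => close (f v) ws) w).
Proof.
elim: ws f => [|u ws IH] f; first exact: deq_refl.
apply: deq_trans (close_equiv ws (lsubst_dmap f w u)) _; exact: IH.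
Qed.

Lemma close_mexp t ws : dequiv (close (DT t) ws) (mexp ws (fun vs => close (DT t) (map DT vs))).
Proof.
elim: ws t => [|w ws IH] t /=; first exact: deq_refl.
apply: deq_trans (close_dmap _ _ _) _.
by apply: dequiv_in_dmap => v _; exact: IH.
Qed.

Lemma evals_mexp ws F G : (forall vs, selects vs ws -> evals (F vs) (G vs)) ->
  evals (mexp ws F) (mexp ws G).
Proof.
elim: ws F G => [|w ws IH] F G h /=; first by apply: h; constructor.
by apply: evals_dmap => v hv; apply: IH => vs hvs; apply: h; constructor.
Qed.

Lemma leaves_mexp ws F t :
  In t (leaves (mexp ws F)) -> exists2 vs, selects vs ws & In t (leaves (F vs)).
Proof.
elim: ws F => [|w ws IH] F /=; first by exists nil => //; constructor.
move=> /leaves_dmap[v hv /IH[vs hvs ht]]; exists (v :: vs) => //; by constructor.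
Qed.

(** A tensor product of unit vectors has norm one. Once the first leaves [v] and [v'] are fixed, the
    tail is an instance with factor [k * ind (v = v')]. *)
Lemma ip_mexp (k : C) ws F G :
  (forall w, In w ws -> ip w w = 1%R) ->
  (forall vs vs', selects vs ws -> selects vs' ws ->
     ip (F vs) (G vs') = (k * ind (vs = vs'))%R) ->
  ip (mexp ws F) (mexp ws G) = k.
Proof.
elim: ws k F G => [|w ws IH] k F G h1 h /=.
  by rewrite h ?ind_true ?mulr1 //; constructor.
rewrite (@ip_dmap k) ?h1 ?mulr1; [by []|by left|] => v v' hv hv'.
apply: IH => [u hu|vs vs' hvs hvs']; first by apply: h1; right.
rewrite h; try by constructor.
by rewrite -mulrA -ind_and; congr (_ * _)%R; apply: ind_iff; split=> [[-> ->]|[-> ->]].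
Qed.

(** * Semantics of translated types *)

Lemma evals_realizes X d e : evals d e -> realizes e X -> realizes d X.
Proof. by move=> h [w [hw xw]]; exists w; split=> //; apply: evals_trans h hw. Qed.

Lemma span_leaves (P : term -> Prop) X d : Defs.span X d ->
  (forall e, X e -> forall t, In t (leaves e) -> P t) ->
  forall t, In t (leaves d) -> P t.
Proof.
move=> [h [l [hh [hl he]]]] hX t /(leaves_equiv he) /leaves_lcomb[p [<-|hp]]; apply: hX => //.
exact: hl.
Qed.

Lemma interp_equiv A d e : dequiv d e -> interp A d -> interp A e.
Proof.
move=> /deq_sym h; case: A => /=.
- exact: deq_trans h.
- by move=> A [v [e' [h1 h2]]]; exists v, e'; split=> //; apply: deq_trans h h1.
- move=> A [[p [l [hp [hl hd]]]] [q [l' [hq [hd' hs]]]]]; split.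
    by exists p, l; do ?split=> //; apply: deq_trans h hd.
  by exists q, l'; do ?split=> //; apply: deq_trans h hd'.
- by move=> A B [] [e' [h1 h2]]; [left|right]; exists e'; split=> //; apply: deq_trans h h2.
- move=> A B [e' [f [h1 [h2 h3]]]]; exists e', f; do ?split=> //; exact: deq_trans h h3.
- by move=> A B [b [h1 h2]]; exists b; split=> //; apply: deq_trans h h1.
- move=> A B [p [l [hp [hl [[q [l' [hq [hd' hs]]]] hd]]]]]; exists p, l; do ?split=> //.
    exact: deq_trans h hp.
  by exists q, l'; do ?split=> //; apply: deq_trans h hd'.
Qed.

Lemma interp_cval A d t : interp A d -> In t (leaves d) -> closedT t /\ is_val t.
Proof.
elim: A d t => /=.
- by move=> d t h /(leaves_equiv h) [<-|[]].
- by move=> A IH d t [v [e [h1 [h2 h3]]]] /(leaves_equiv h1) [<-|[]]; apply: IH h2 h3.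
- by move=> A IH d t [hs _]; move: t; apply: (span_leaves hs) => e he t; apply: IH.
- move=> A IHA B IHB d t [] [e [he hd]] /(leaves_equiv hd) /leaves_dmap[s hs [<-|[]]];
  [have [h1 h2] := IHA _ _ he hs|have [h1 h2] := IHB _ _ he hs]; by split.
- move=> A IHA B IHB d t [e [f [he [hf hd]]]] /(leaves_equiv hd).
  move=> /leaves_dmap[s /(IHA _ _ he)[h1 h2] /leaves_dmap[u /(IHB _ _ hf)[h3 h4] [<-|[]]]].
  by split=> // n /=; rewrite h1 h3.
- by move=> A _ B _ d t [b [hd [hc _]]] /(leaves_equiv hd) [<-|[]].
- move=> A _ B _ d t [p [l [hd [hc _]]]] /(leaves_equiv hd) /leaves_lcomb[q].
  rewrite -[(_, _) :: _]/(map (fun p : C * dist => (p.1, DT (Lam p.2))) (p :: l)).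
  by move=> /in_map_iff[q' [<- hq']] [<-|[]]; split=> //; exact: hc.
Qed.

(** In a translated classical type [TSharp] and [TDarr] occur only below [TArr], whose elements are
    single abstractions. Hence classical variables are never in superposition. *)
Lemma trC_pure A d : interp (trC A) d -> exists v, dequiv d (DT v).
Proof.
elim: A d => [|A IHA B IHB|A IHA B IHB||A B] d /=.
- by exists Unit.
- by move=> [b [h _]]; exists (Lam b).
- move=> [e [f [/IHA[v hv] [/IHB[w hw] h]]]]; exists (Pair v w); apply: deq_trans h _.
  apply: deq_trans (dequiv_dmap _ hv) _; exact: dequiv_dmap hw.
- move=> [] [e [he hd]]; [exists (Inl Unit)|exists (Inr Unit)];
  by apply: deq_trans hd _; apply: dequiv_dmap he.
- by move=> [b [h _]]; exists (Lam b).
Qed.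

(** Makes the lower bound on free variables in [valid] concern quantum variables only. *)
Lemma trC_flat A d : interp (trC A) d <-> interp (TFlat (trC A)) d.
Proof.
split=> [h|/= [v [e [hv [he hi]]]]].
  by have [v hv] := trC_pure h; exists v, d; rewrite (leaves_equiv hv); do ?split=> //; left.
have [v' hv'] := trC_pure he; move: hi => /(leaves_equiv hv') [E|//].
by apply: interp_equiv he; apply: deq_trans hv' _; rewrite E; apply: deq_sym.
Qed.

Lemma realizes_trC A d : realizes d (interp (trC A)) ->
  exists v, [/\ evals d (DT v), interp (trC A) (DT v), closedT v & is_val v].
Proof.
move=> [w [hw iw]]; have [v hv] := trC_pure iw.
have iv := interp_equiv hv iw; have [|hc hl] := @interp_cval _ _ v iv; first by left.
by exists v; split=> //; apply: evals_trans hw _; apply: evals_equiv.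
Qed.

(** * Quantum types: basis values and unit spheres *)

Fixpoint qbasis (A : qtype) (t : term) : Prop :=
  match A with
  | QBit => t = ttrue \/ t = tfalse
  | QTens A B => exists a b, [/\ t = Pair a b, qbasis A a & qbasis B b]
  end.

Definition qvec (A : qtype) (d : dist) : Prop := forall t, In t (leaves d) -> qbasis A t.

Lemma qbasis_cval A t : qbasis A t -> closedT t /\ is_val t.
Proof.
elim: A t => [|A IHA B IHB] t /=; first by case=> ->.
by move=> [a [b [-> /IHA[h1 h2] /IHB[h3 h4]]]]; split=> // n /=; rewrite h1 h3.
Qed.

Lemma qvec_vals A d : qvec A d -> vals d.
Proof. by move=> h t /h /qbasis_cval[]. Qed.

Lemma qvec_equiv A d e : dequiv d e -> qvec A d -> qvec A e.
Proof. by move=> h hd t /(leaves_equiv h) /hd. Qed.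

Lemma ip_DTid t : ip (DT t) (DT t) = 1%R.
Proof. by rewrite ip_DT ind_true. Qed.

Lemma span_qvec (A : qtype) X d :
  (forall t, qbasis A t -> X (DT t)) -> qvec A d -> Defs.span X d.
Proof.
move=> hX hd; have [h [l [he _]]] := dequiv_tcomb d.
have {}hd p : In p (h :: l) -> X (DT p.2).
  move=> hp; apply/hX/hd/(leaves_equiv he)/leaves_lcomb; exists (p.1, DT p.2); last by left.
  exact: (in_map (fun p : C * term => (p.1, DT p.2)) (h :: l)).
exists (h.1, DT h.2), (map (fun p => (p.1, DT p.2)) l); split; first by apply: hd; left.
by split=> // q /in_map_iff[p [<- hp]]; apply: hd; right.
Qed.

Lemma interp_sharp A d :
  interp (TSharp A) d <-> Defs.span (interp A) d /\ ip d d = 1%R.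
Proof. by rewrite -sphereP. Qed.

(** For a tensor, a pair of vectors expands into basis pairs, and each basis pair is itself a pair
    of unit vectors; requiring norm one of the components therefore does not shrink the span. *)
Lemma interp_trQ A d : interp (trQ A) d <-> qvec A d /\ ip d d = 1%R.
Proof.
elim: A d => [|A IHA B IHB] d; rewrite [trQ _]/= interp_sharp; split.
- move=> [hs ->]; split=> //; move: hs => /span_leaves; apply=> e [] [f [hf he]] t;
  rewrite (leaves_equiv he) => /leaves_dmap[s /(leaves_equiv hf) [<-|[]] [<-|[]]];
  by [left|right].
- move=> [hd ->]; split=> //; apply: span_qvec hd => t [] ->;
  by [left; exists (DT Unit); split; apply: deq_refl|
      right; exists (DT Unit); split; apply: deq_refl].
- move=> [hs ->]; split=> //; move: hs => /span_leaves; apply=> e [f [g [hf [hg he]]]] t.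
  rewrite (leaves_equiv he) => /leaves_dmap[s hs /leaves_dmap[u hu [<-|[]]]].
  exists s, u; split=> //; first by apply: (proj1 (proj1 (IHA _) hf)).
  by apply: (proj1 (proj1 (IHB _) hg)).
- move=> [hd ->]; split=> //; apply: span_qvec hd => t [a [b [-> ha hb]]].
  exists (DT a), (DT b); split; first by apply/IHA; rewrite ip_DTid; split=> // t' [<-|[]].
  by split; [apply/IHB; rewrite ip_DTid; split=> // t' [<-|[]]|exact: deq_refl].
Qed.

(** No norm condition is included: norms are recovered separately, from [ip] of normal forms. *)
Definition bev (A : qtype) (d : dist) : Prop := exists2 w, evals d w & qvec A w.

Lemma bev_NF A d : bev A d -> evals d (NF d) /\ qvec A (NF d).
Proof.
move=> [w hw qw]; have vw := qvec_vals qw; split; first exact: evals_NF hw vw.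
by apply: qvec_equiv qw; apply: deq_sym; apply: NF_unique.
Qed.

Lemma NF_evals A d e : evals d e -> bev A e -> bev A d /\ dequiv (NF d) (NF e).
Proof.
move=> h /bev_NF[he qe]; have hd := evals_trans h he; split; first by exists (NF e).
by apply: NF_unique => //; exact: qvec_vals qe.
Qed.

(** The context first evaluates [s], then runs on each basis value obtained, so the result of [K s]
    is linear in the result of [s]. *)
Lemma bev_bind K A B s : frame K -> bev A (DT s) ->
  (forall p, qbasis A p -> bev B (DT (K p))) ->
  bev B (DT (K s)) /\
  dequiv (NF (DT (K s))) (dmap (fun p => NF (DT (K p))) (NF (DT s))).
Proof.
move=> hK /bev_NF[hs qs] hB; set w := dmap _ _.
have hw : evals (DT (K s)) w.
  apply: evals_trans (evals_frame hK hs) _; apply: evals_dmap => p /qs /hB.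
  by case/bev_NF.
have qw : qvec B w by move=> t /leaves_dmap[p /qs/hB/bev_NF[_ h] /h].
by split; [exists w|apply: NF_unique => //; apply: qvec_vals qw].
Qed.

(** In use, [K] and [K'] are one construct under two assignments of its variables. Sequencing
    multiplies inner products: [k] accounts for the context, the other factor for the subterm in the
    hole. *)
Lemma iso_bind (k : C) K K' A B s s' :
  frame K -> frame K' -> bev A (DT s) -> bev A (DT s') ->
  (forall p, qbasis A p -> bev B (DT (K p))) ->
  (forall p, qbasis A p -> bev B (DT (K' p))) ->
  (forall p p', qbasis A p -> qbasis A p' ->
     ip (NF (DT (K p))) (NF (DT (K' p'))) = (k * ind (p = p'))%R) ->
  ip (NF (DT (K s))) (NF (DT (K' s'))) = (k * ip (NF (DT s)) (NF (DT s')))%R.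
Proof.
move=> hK hK' hs hs' hB hB' h.
have [_ E] := bev_bind hK hs hB; have [_ E'] := bev_bind hK' hs' hB'.
rewrite (ip_equiv E E'); apply: ip_dmap => p p' hp hp'.
by apply: h; [apply: (proj2 (bev_NF hs))|apply: (proj2 (bev_NF hs'))].
Qed.

Lemma iso_realizes A B F :
  (forall b, qbasis A b -> bev B (F b)) ->
  (forall b b', qbasis A b -> qbasis A b' -> ip (NF (F b)) (NF (F b')) = ind (b = b')) ->
  forall u, interp (trQ A) u -> realizes (dmap F u) (interp (trQ B)).
Proof.
move=> hB h u /interp_trQ[qu nu]; exists (dmap (fun b => NF (F b)) u); split.
  by apply: evals_dmap => b /qu /hB /bev_NF[].
apply/interp_trQ; split; first by move=> t /leaves_dmap[p /qu/hB/bev_NF[_ h'] /h'].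
by rewrite (@ip_dmap 1%R) ?nu ?mulr1 // => s t hs ht; rewrite mul1r h //; exact: qu.
Qed.

(** Gives a unit vector with two nonzero rational coordinates; this avoids square roots, and
    conjugation fixes the coordinates. *)
Lemma pythagoras_345 (F : numFieldType) : (3 / 5 * (3 / 5) + 4 / 5 * (4 / 5) = 1 :> F)%R.
Proof. by field. Qed.

(* Polarization: evaluating at (3/5) b + (4/5) c b' for c = 1 and c = i
   forces the inner product of the images of b and b' to vanish. *)
Lemma realizes_iso A B F :
  (forall u, interp (trQ A) u -> realizes (dmap F u) (interp (trQ B))) ->
  (forall b, qbasis A b -> bev B (F b)) /\
  (forall b b', qbasis A b -> qbasis A b' -> ip (NF (F b)) (NF (F b')) = ind (b = b')).
Proof.
move=> hF.
have hb b : qbasis A b -> bev B (F b) /\ ip (NF (F b)) (NF (F b)) = 1%R.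
  move=> qb; have [|w [/= hw /interp_trQ[qw nw]]] := hF (DT b).
    by apply/interp_trQ; rewrite ip_DTid; split=> // t [<-|[]].
  have E := NF_unique hw (qvec_vals qw).
  by rewrite (ip_equiv E E); split=> //; exists w.
split=> [b /hb[]//|b b' qb qb'].
case: (pselect (b = b')) => [<-|ne]; first by rewrite ind_true //; case: (hb _ qb).
rewrite ind_false //; set z := ip _ _.
have [bb nb] := hb _ qb; have [bb' nb'] := hb _ qb'.
have hz (c : C) : (c^* * c = 1 -> c * z + (c * z)^* = 0)%R.
  move=> hc; pose al : C := (3 / 5)%R; pose be : C := (4 / 5 * c)%R.
  have cal : (al^* = al)%R by rewrite /al fmorph_div !rmorph_nat.
  have cbe : (be^* = 4 / 5 * c^*)%R by rewrite /be rmorphM fmorph_div !rmorph_nat.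
  have n1 : (al^* * al + be^* * be = 1)%R.
    by rewrite cal cbe [X in (_ + X)%R]mulrACA hc mulr1 pythagoras_345.
  have [|w [hw /interp_trQ[qw nw]]] := hF (DAdd (DScal al (DT b)) (DScal be (DT b'))).
    apply/interp_trQ; split; first by move=> t [<-|[<-|[]]].
    rewrite !ip_addl !ip_addr !ip_scall !ip_scalr !ip_DTid !ip_DT !ind_false //; last exact: nesym.
    by rewrite !mulr0 !mulr1 addr0 add0r.
  (* Uniqueness of results identifies the value of the superposed input with the superposition of
     the two normal forms. *)
  have {}hw : dequiv (DAdd (DScal al (NF (F b))) (DScal be (NF (F b')))) w.
    apply: deq_sym; apply: evals_unique hw _ (qvec_vals qw) _.
      by apply: evals_add; apply: evals_scal; [case: (bev_NF bb)|case: (bev_NF bb')].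
    have [[_ q] [_ q']] := (bev_NF bb, bev_NF bb').
    by move=> t /in_app_iff[]; [apply: (qvec_vals q)|apply: (qvec_vals q')].
  (* In the expanded norm the diagonal part is already 1, so the cross term and its conjugate must
     sum to zero. *)
  rewrite -(ip_equiv hw hw) !ip_addl !ip_addr !ip_scall !ip_scalr in nw.
  rewrite nb nb' [ip (NF (F b')) _]ip_conj -/z !mulr1 in nw.
  rewrite [X in (_ + X)%R]addrC addrACA n1 cal cbe /be in nw.
  move/eqP: nw; rewrite -subr_eq0 addrAC subrr add0r => /eqP hs.
  have ne0 : (al * (4 / 5))%R != 0%R.
    by rewrite !mulf_neq0 ?invr_eq0 ?pnatr_eq0.
  apply: (mulfI ne0); rewrite mulr0 -[RHS]hs mulrDr -!mulrA; congr (_ + _)%R.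
  by rewrite rmorphM; ring.
(* Up to nonzero factors, [c = 1] isolates the real part of [z] and [c = 'i] the imaginary part. *)
have h1 : (z + z^* = 0)%R by have := hz 1%R; rewrite conjC1 mulr1 !mul1r => /(_ erefl).
have h2 : (z - z^* = 0)%R.
  have := hz 'i%R; rewrite conjCi mulNr -expr2 sqrCi opprK => /(_ erefl).
  rewrite rmorphM /= conjCi mulNr -mulrBr => /eqP.
  by rewrite mulf_eq0 (negbTE (neq0Ci _)) => /eqP.
have : (z *+ 2 = 0)%R by rewrite mulr2n -[z in (_ + z)%R](subrK z^*%R) h2 add0r.
by move/eqP; rewrite mulrn_eq0 => /eqP.
Qed.

(** * Free variables and environments *)

Lemma evals_lcomb (T : Type) (h : C * T) (l : list (C * T)) (F G : T -> dist) :
  (forall x, evals (F x) (G x)) ->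
  evals (lcomb (h.1, F h.2) (map (fun p => (p.1, F p.2)) l))
        (lcomb (h.1, G h.2) (map (fun p => (p.1, G p.2)) l)).
Proof.
move=> hFG; elim/last_ind: l => [|l p IH].
  by rewrite /lcomb /=; apply: evals_scal; apply: hFG.
by rewrite rcons_app !map_app !lcomb_rcons; apply: (evals_add IH); apply: evals_scal; apply: hFG.
Qed.

(** An element of [TDarr] is a superposition of abstractions; applied to a value it superposes the
    substituted bodies, and that superposition is [F]. In this form [realizes_iso] applies. *)
Lemma darr_elim A B f : interp (TDarr A B) f ->
  exists F : term -> dist,
    (forall v, is_val v -> evals (dmap (fun s => DT (App s v)) f) (F v)) /\
    (forall u, interp A u -> realizes (dmap F u) (interp B)).
Proof.
move=> /= [h [l [hf [_ [_ hr]]]]].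
exists (fun v => lcomb (h.1, substD 0 v h.2) (map (fun p => (p.1, substD 0 v p.2)) l)); split.
  move=> v hv; apply: evals_trans; first by apply: evals_equiv; apply: dequiv_dmap hf.
  rewrite dmap_lcomb map_map /=.
  apply: (evals_lcomb h l (F := fun d => DT (App (Lam d) v)) (G := fun d => substD 0 v d)).
  by move=> d; apply: evals_red1; apply: r_beta.
move=> u /hr; apply: evals_realizes; apply: evals_equiv.
exact: (dmap_lcombf h l (fun d v => substD 0 v d)).
Qed.

Scheme ctyping_mut := Minimality for ctyping Sort Prop
  with qtyping_mut := Minimality for qtyping Sort Prop.
Combined Scheme typing_ind from ctyping_mut, qtyping_mut.

Lemma names_perm T (G G1 G2 : list (nat * T)) x : Permutation G (G1 ++ G2) ->
  In x (names G) <-> In x (names G1) \/ In x (names G2).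
Proof.
move=> hG; rewrite -in_app_iff /names -map_app; split; apply: Permutation_in.
  exact: Permutation_map.
by apply: Permutation_sym; apply: Permutation_map.
Qed.

Lemma typing_sfv :
  (forall D t A, ctyping D t A -> forall x, In x (sfv t) -> In x (names D)) /\
  (forall D G t A, qtyping D G t A ->
    (forall x, In x (sfv t) -> In x (names D) \/ In x (names G)) /\
    (forall x, In x (names G) -> In x (sfv t))).
Proof.
apply: typing_ind => /=.
- by move=> D x A h y [<-|[]]; apply: (in_map fst _ (x, A)).
- by [].
- by move=> D x A B t _ _ IH y /filter_In[/IH [<-|//]]; rewrite eqxx.
- by move=> D t r A B _ IH1 _ IH2 x /in_app_iff[/IH1|/IH2].
- by move=> D t r A B _ IH1 _ IH2 x /in_app_iff[/IH1|/IH2].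
- by move=> D t A B _ IH x /IH.
- by move=> D t A B _ IH x /IH.
- by [].
- by [].
- by move=> D t r s A _ IH1 _ IH2 _ IH3 x /in_app_iff[/IH1|/in_app_iff[/IH2|/IH3]].
- by move=> D x A B t _ _ [IH _] y /filter_In[/IH [//|[<-|//]]]; rewrite eqxx.
- by move=> D x A; split=> y; auto.
- move=> D G G1 G2 s t A B _ [h1 h1'] _ [h2 h2'] hG; split=> x.
    by rewrite (names_perm _ hG) in_app_iff => -[/h1[]|/h2[]]; auto.
  by rewrite (names_perm _ hG) in_app_iff => -[/h1'|/h2']; auto.
- by move=> D G U t _ IH.
- move=> D G G1 G2 x y s t A B C' _ _ _ nx ny _ [h1 h1'] _ [h2 h2'] hG; split=> z.
    rewrite (names_perm _ hG) in_app_iff => -[/h1[]|]; auto.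
    by move=> /filter_In[/h2 [|[<-|[<-|]]]]; rewrite ?eqxx ?andbF; auto.
  rewrite (names_perm _ hG) in_app_iff => -[/h1'|hz]; auto; right.
  apply/filter_In; split; first by apply: h2'; right; right.
  by apply/andP; split; apply/eqP => E; subst.
- by move=> D t _ IH; split=> // x /IH; left.
- move=> D G s t A B _ IH _ [h1 h2]; split=> x; rewrite in_app_iff.
    by move=> [/IH|/h1]; auto.
  by move=> /h2; right.
Qed.

Lemma idx_there e x y : y <> x -> idx (Some x :: e) y = (idx e y).+1.
Proof. by move=> ne /=; case: eqP => // -[/esym]. Qed.

Lemma occ_tr t e n : occT n (tr e t) <-> exists x, In x (sfv t) /\ idx e x = n.
Proof.
have orE (b c : bool) P Q : (b <-> P) -> (c <-> Q) -> (b || c <-> P \/ Q).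
  by move=> <- <-; split=> /orP.
have binE (l l' : list nat) (P : nat -> Prop) :
    (exists x, In x (l ++ l') /\ P x) <->
    (exists x, In x l /\ P x) \/ (exists x, In x l' /\ P x).
  split=> [[x [/in_app_iff[] hx px]]|[] [x [hx px]]].
  - by left; exists x.
  - by right; exists x.
  - by exists x; rewrite in_app_iff; auto.
  - by exists x; rewrite in_app_iff; auto.
elim: t e n => //=.
- by move=> x e n; split=> [/eqP <-|[y [[<-|[]] <-]]]; [exists x; auto|].
- by move=> e n; split=> // -[x []].
- move=> x t IH e n; rewrite IH; split=> -[y].
    move=> [hy] /=; case: eqP => // ne [<-]; exists y; split=> //.
    by apply/filter_In; split=> //; apply/eqP => E; apply: ne; rewrite E.
  move=> [/filter_In[hy ne] <-]; exists y; split=> //.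
  by rewrite idx_there //; apply/eqP.
- by move=> s IHs t IHt e n; rewrite binE; apply: (orE).
- by move=> s IHs t IHt e n; rewrite binE; apply: (orE).
- by move=> t IH e n; rewrite orbF.
- by move=> t IH e n; rewrite orbF.
- by move=> e n; split=> // -[x []].
- by move=> e n; split=> // -[x []].
(* The [None] entry stands for the fresh variable of a branch: it shifts every index and is the
   index of no name. *)
- have skip t e n : (exists x, In x (sfv t) /\ idx (None :: e) x = n.+1) <->
      exists x, In x (sfv t) /\ idx e x = n.
    by split=> -[x [h1 h2]]; exists x; split=> //; [case: h2|rewrite /= h2].
  move=> t IHt r IHr s IHs e n; rewrite !binE; apply: (orE) => //.
  by apply: (orE); rewrite ?IHr ?IHs.
- by move=> s IHs t IHt e n; rewrite binE; apply: (orE).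
- move=> x y s IHs t IHt e n; rewrite binE; apply: (orE) => //; rewrite IHt; split=> -[z].
    move=> [hz] /=; case: eqP => // ne1; case: eqP => // ne2 [<-]; exists z; split=> //.
    apply/filter_In; split=> //.
    by apply/andP; split; apply/eqP => E; [apply: ne2|apply: ne1]; rewrite E.
  move=> [/filter_In[hz /andP[n1 n2]] <-]; exists z; split=> //.
  by rewrite !idx_there //; apply/eqP.
- move=> x t IH e n; rewrite IH; split=> -[y].
    move=> [hy] /=; case: eqP => // ne [<-]; exists y; split=> //.
    by apply/filter_In; split=> //; apply/eqP => E; apply: ne; rewrite E.
  move=> [/filter_In[hy ne] <-]; exists y; split=> //.
  by rewrite idx_there //; apply/eqP.
- by move=> s IHs t IHt e n; rewrite binE orbF; apply: (orE).
Qed.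

Definition lookup (e : env) (vs : list term) (x : nat) : term := vnth vs (idx e x).

Lemma lookup_here e vs v x : lookup (Some x :: e) (v :: vs) x = v.
Proof. by rewrite /lookup /= eqxx. Qed.

Lemma lookup_there e vs v x y : y <> x -> lookup (Some x :: e) (v :: vs) y = lookup e vs y.
Proof. by move=> ne; rewrite /lookup idx_there. Qed.

Definition okC (D : list (nat * ctype)) e vs : Prop :=
  forall x A, In (x, A) D -> interp (trC A) (DT (lookup e vs x)).

Definition okQ (G : list (nat * qtype)) e vs : Prop :=
  forall x A, In (x, A) G -> qbasis A (lookup e vs x).

Definition agree (xs : list nat) e vs vs' : Prop :=
  forall x, In x xs -> lookup e vs x = lookup e vs' x.

Lemma instT_agree e vs vs' t :
  agree (sfv t) e vs vs' -> instT 0 vs (tr e t) = instT 0 vs' (tr e t).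
Proof.
by move=> h; apply: (proj1 inst_ext) => n; rewrite add0n => /occ_tr[x [hx <-]]; apply: h.
Qed.

Lemma In_names T (G : list (nat * T)) x A : In (x, A) G -> In x (names G).
Proof. exact: (in_map fst _ (x, A)). Qed.

Lemma okC_agree D e vs vs' : agree (names D) e vs vs' -> okC D e vs -> okC D e vs'.
Proof. by move=> h hD x A hx; rewrite -h; [apply: hD|apply: In_names hx]. Qed.

Lemma okC_there D e vs x v : ~ In x (names D) -> okC D e vs -> okC D (Some x :: e) (v :: vs).
Proof.
move=> nx h y A hy; rewrite lookup_there; first exact: h.
by move=> E; apply: nx; rewrite -E; apply: In_names hy.
Qed.

Lemma okC_cons D e vs x A v : ~ In x (names D) -> okC D e vs -> interp (trC A) (DT v) ->
  okC ((x, A) :: D) (Some x :: e) (v :: vs).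
Proof.
move=> nx h hv y B [[<- <-]|hy]; first by rewrite lookup_here.
exact: okC_there hy.
Qed.

Lemma okQ_there G e vs x v : ~ In x (names G) -> okQ G e vs -> okQ G (Some x :: e) (v :: vs).
Proof.
move=> nx h y A hy; rewrite lookup_there; first exact: h.
by move=> E; apply: nx; rewrite -E; apply: In_names hy.
Qed.

Lemma okQ_here G e vs x A v : qbasis A v -> okQ G (Some x :: e) (v :: vs) ->
  okQ ((x, A) :: G) (Some x :: e) (v :: vs).
Proof. by move=> hv h y B [[<- <-]|/h//]; rewrite lookup_here. Qed.

Lemma agree_there xs e x v v' vs vs' : ~ In x xs ->
  agree xs (Some x :: e) (v :: vs) (v' :: vs') <-> agree xs e vs vs'.
Proof.
move=> nx; split=> h y hy; have ne : y <> x by move=> E; rewrite E in hy.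
  by have := h y hy; rewrite !lookup_there.
by rewrite !lookup_there //; apply: h.
Qed.

Lemma agree_cons x xs e vs vs' : agree (x :: xs) e vs vs' <->
  lookup e vs x = lookup e vs' x /\ agree xs e vs vs'.
Proof.
split=> [h|[h1 h2] y [<-//|/h2//]].
by split=> [|y hy]; apply: h; [left|right].
Qed.

Lemma agree_perm T (G G1 G2 : list (nat * T)) e vs vs' : Permutation G (G1 ++ G2) ->
  agree (names G) e vs vs' <->
  agree (names G1) e vs vs' /\ agree (names G2) e vs vs'.
Proof.
move=> hG; split=> [h|[h1 h2] x /(names_perm _ hG)[/h1|/h2]//].
by split=> x hx; apply: h; apply/(names_perm _ hG); [left|right].
Qed.

(** * Semantics of translated terms *)

Lemma NF_basis A b : qbasis A b -> bev A (DT b) /\ dequiv (NF (DT b)) (DT b).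
Proof.
move=> hb; have qb : qvec A (DT b) by move=> t [<-|[]].
split; first by exists (DT b) => //; exact: evals_refl.
by apply: NF_unique; [exact: evals_refl|exact: qvec_vals qb].
Qed.

Lemma lsubst_inst vs t w : cvals vs ->
  lsubst (DT (instT 1 vs t)) w = dmap (fun u => DT (instT 0 (u :: vs) t)) w.
Proof.
by move=> hvs; apply: eq_in_dmap => u _ /=; rewrite (proj1 (subst_inst u hvs)).
Qed.

(** An element of a classical type is congruent to one closed value, and substitution respects the
    congruence in the substituted distribution. *)
Lemma realizes_lsubst_pure A X d :
  (forall v, closedT v -> is_val v -> interp (trC A) (DT v) -> realizes (lsubst d (DT v)) X) ->
  forall w, interp (trC A) w -> realizes (lsubst d w) X.
Proof.
move=> h w hw; have [v hv] := trC_pure hw; have iv := interp_equiv hv hw.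
have [|hc hl] := @interp_cval _ _ v iv; first by left.
by apply: evals_realizes (h v hc hl iv); apply: evals_equiv; apply: dequiv_dmap.
Qed.

(** * Gates and applied quantum functions *)

Section Gates.
Local Open Scope ring_scope.

(** Column [j] of the matrix, as a vector of type [QBit]. *)
Definition gate_image (U : gate) (j : 'I_2) : dist :=
  DAdd (DScal (gmx U ord0 j) (DT ttrue)) (DScal (gmx U ord_max j) (DT tfalse)).

Lemma ip_gate_image U j j' : ip (gate_image U j) (gate_image U j') = (j == j')%:R.
Proof.
(* [unitary2] says that the rows are orthonormal; [mulmx1C] passes to the columns, which are the
   images of the basis. *)
have /(congr1 (fun M : 'M_2 => M j j')) := mulmx1C (gmx_unitary U).
rewrite !mxE => <-; rewrite !big_ord_recl big_ord0 addr0 !mxE.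
rewrite (_ : lift ord0 ord0 = ord_max :> 'I_2); last exact: val_inj.
rewrite !ip_addl !ip_addr !ip_scall !ip_scalr !ip_DTid !ip_DT !ind_false //.
by rewrite !mulr0 !mulr1 addr0 add0r.
Qed.

Lemma evals_gate U : evals (DT (App (Ubar U) ttrue)) (gate_image U ord0) /\
  evals (DT (App (Ubar U) tfalse)) (gate_image U ord_max).
Proof.
by split; (apply: evals_trans; first by apply: evals_red1; apply: r_beta);
   apply: evals_red1; [apply: r_inl|apply: r_inr].
Qed.

Lemma gate_iso U :
  (forall b, qbasis QBit b -> bev QBit (DT (App (Ubar U) b))) /\
  (forall b b', qbasis QBit b -> qbasis QBit b' ->
     ip (NF (DT (App (Ubar U) b))) (NF (DT (App (Ubar U) b'))) = ind (b = b')).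
Proof.
have [h1 h2] := evals_gate U.
have q j : qvec QBit (gate_image U j) by move=> t [<-|[<-|[]]]; [left|right].
have E1 := NF_unique h1 (qvec_vals (q _)); have E2 := NF_unique h2 (qvec_vals (q _)).
split=> [b [] ->|b b' [] -> [] ->].
- by exists (gate_image U ord0).
- by exists (gate_image U ord_max).
- by rewrite (ip_equiv E1 E1) ip_gate_image ind_true.
- by rewrite (ip_equiv E1 E2) ip_gate_image ind_false.
- by rewrite (ip_equiv E2 E1) ip_gate_image ind_false.
- by rewrite (ip_equiv E2 E2) ip_gate_image ind_true.
Qed.

End Gates.

(** Applied to [Unit], the realizer evaluates to a superposition of abstractions, which [darr_elim]
    presents as a linear map on values; [realizes_iso] then applies to that map. *)
Lemma appQ_iso A B s : realizes (DT s) (interp (trC (CLoll A B))) ->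
  (forall b, qbasis A b -> bev B (DT (App (App s Unit) b))) /\
  (forall b b', qbasis A b -> qbasis A b' ->
     ip (NF (DT (App (App s Unit) b))) (NF (DT (App (App s Unit) b'))) = ind (b = b')).
Proof.
move=> [w [hw [body [hb [_ hbody]]]]].
have [f [hf /darr_elim[F [hF /realizes_iso[F1 F2]]]]] := hbody (DT Unit) (deq_refl _).
have hs : evals (DT (App s Unit)) f.
  apply: evals_trans hf.
  apply: (@evals_trans (DT (App (Lam body) Unit))); last by apply: evals_red1; apply: r_beta.
  have {}hw : evals (DT s) (DT (Lam body)) by apply: evals_trans hw (evals_equiv hb).
  exact: (evals_frame (frame_appL (v := Unit) I) hw).
have h b : qbasis A b -> bev B (DT (App (App s Unit) b)) /\
    dequiv (NF (DT (App (App s Unit) b))) (NF (F b)).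
  move=> qb; have [_ vb] := qbasis_cval qb; apply: NF_evals (F1 _ qb).
  apply: evals_trans (hF _ vb); exact: (evals_frame (frame_appL vb) hs).
split=> [b /h[]//|b b' qb qb']; have [_ E] := h _ qb; have [_ E'] := h _ qb'.
by rewrite (ip_equiv E E') F2.
Qed.

Lemma subst_inst_comm vs v : cvals vs -> closedT v ->
  (forall t k, substT k v (instT k.+2 vs t) = instT k.+1 vs (substT k v t)) /\
  (forall d k, substD k v (instD k.+2 vs d) = instD k.+1 vs (substD k v d)).
Proof.
move=> hvs hv; apply: term_dist_ind => /=; try by move=> *; congruence.
move=> n k; case: (ltnP n k.+2) => hn /=; case: (ltngtP n k) => hk /=; try by lia.
- by case: ltnP => //; lia.
- by case: ltnP => //; lia.
- by rewrite instT_closed.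
rewrite substT_closed; last by case: (cvals_vnth (n - k.+2) hvs).
case: ltnP => hn'; first by lia.
by congr (vnth _ _); lia.
Qed.

(** [r_let] fills index 0 with the second component and then, the indices having dropped, index 0
    again with the first; hence the order [c' :: c]. *)
Lemma evals_let vs c c' t : cvals vs -> closedT c' -> is_val c -> is_val c' ->
  evals (DT (Let (Pair c c') (DT (instT 2 vs t)))) (DT (instT 0 (c' :: c :: vs) t)).
Proof.
move=> hvs hc' vc vc'; apply: evals_trans; first by apply: evals_red1; apply: r_let.
rewrite /= (proj1 (subst_inst_comm hvs hc')) (proj1 (subst_inst c hvs)).
by rewrite (proj1 (inst_subst _ hc')); exact: evals_refl.
Qed.

Lemma evals_frame1 K s v : frame K -> evals (DT s) (DT v) -> evals (DT (K s)) (DT (K v)).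
Proof. by move=> hK /(evals_frame hK). Qed.

(** * Semantic judgments and the typing rules *)

Definition tm (e : env) (vs : list term) (t : sterm) : term := instT 0 vs (tr e t).

Definition semC (D : list (nat * ctype)) (t : sterm) (A : ctype) : Prop :=
  forall e vs, cvals vs -> okC D e vs -> realizes (DT (tm e vs t)) (interp (trC A)).

(** Agreement is tested on the names of [G] only, because the lists of values also hold the quantum
    variables of other subterms. *)
Definition semQ (D : list (nat * ctype)) (G : list (nat * qtype)) (t : sterm) (A : qtype) : Prop :=
  forall e vs, cvals vs -> okC D e vs -> okQ G e vs ->
    bev A (DT (tm e vs t)) /\
    forall vs', cvals vs' -> agree (names D) e vs vs' -> okQ G e vs' ->
      ip (NF (DT (tm e vs t))) (NF (DT (tm e vs' t))) = ind (agree (names G) e vs vs').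

Lemma semC_lam D x A B t : ~ In x (names D) -> semC ((x, A) :: D) t B ->
  semC D (SLam x t) (CArr A B).
Proof.
move=> nx IH e vs hvs hD; exists (DT (tm e vs (SLam x t))); split; first exact: evals_refl.
exists (DT (instT 1 vs (tr (Some x :: e) t))); split; first exact: deq_refl.
split; first exact: (closed_instT (Lam (DT (tr (Some x :: e) t))) hvs).
apply: realizes_lsubst_pure => v hc hv iv; rewrite lsubst_inst //.
by apply: IH; [apply: cvals_cons|apply: okC_cons].
Qed.

Lemma semC_app D t r A B : semC D t (CArr A B) -> semC D r A -> semC D (SApp t r) B.
Proof.
move=> IHt IHr e vs hvs hD.
have [v [hv iv cv vv]] := realizes_trC (IHr e vs hvs hD).
have [w [hw [body [hb [_ hB]]]]] := IHt e vs hvs hD.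
apply: evals_realizes (hB _ iv).
apply: evals_trans (evals_frame1 (frame_appR _) hv) _.
apply: evals_trans.
  exact: (evals_frame1 (frame_appL vv) (evals_trans hw (evals_equiv hb))).
by apply: evals_red1; apply: r_beta.
Qed.

Lemma semC_pair D t r A B : semC D t A -> semC D r B -> semC D (SPair t r) (CProd A B).
Proof.
move=> IHt IHr e vs hvs hD.
have [v [hv iv cv vv]] := realizes_trC (IHr e vs hvs hD).
have [u [hu iu _ _]] := realizes_trC (IHt e vs hvs hD).
exists (DT (Pair u v)); split; last by exists (DT u), (DT v); do ?split=> //; exact: deq_refl.
apply: evals_trans (evals_frame1 (frame_pairR _) hv) _.
exact: (evals_frame1 (frame_pairL vv) hu).
Qed.

Lemma realizes_trC_prod A B s : realizes (DT s) (interp (trC (CProd A B))) ->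
  exists v w, [/\ evals (DT s) (DT (Pair v w)), interp (trC A) (DT v), interp (trC B) (DT w),
    closedT v /\ is_val v & closedT w /\ is_val w].
Proof.
move=> [d [hd [e [f [he [hf hE]]]]]].
have [v hv] := trC_pure he; have [w hw] := trC_pure hf.
have iv := interp_equiv hv he; have iw := interp_equiv hw hf.
exists v, w; split=> //; try by [apply: interp_cval iv _; left|apply: interp_cval iw _; left].
apply: (evals_trans hd); apply: evals_equiv; apply: deq_trans hE _.
by apply: deq_trans (dequiv_dmap _ hv) _; apply: dequiv_dmap hw.
Qed.

Lemma semC_pi1 D t A B : semC D t (CProd A B) -> semC D (SPi1 t) A.
Proof.
move=> IH e vs hvs hD.
have [v [w [h iv iw [cv vv] [cw vw]]]] := realizes_trC_prod (IH e vs hvs hD).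
exists (DT v); split=> //; apply: evals_trans (evals_frame1 (frame_let _) h) _.
exact: (evals_red1 (r_let (DT (Var 1)) vv vw)).
Qed.

Lemma semC_pi2 D t A B : semC D t (CProd A B) -> semC D (SPi2 t) B.
Proof.
move=> IH e vs hvs hD.
have [v [w [h iv iw [cv vv] [cw vw]]]] := realizes_trC_prod (IH e vs hvs hD).
exists (DT w); split=> //; apply: evals_trans (evals_frame1 (frame_let _) h) _.
by have := evals_red1 (r_let (DT (Var 0)) vv vw); rewrite /= substT_closed.
Qed.

Lemma realizes_bit s : realizes (DT s) (interp (trC CBit)) ->
  exists2 b, evals (DT s) (DT b) & qbasis QBit b.
Proof.
move=> [w [hw iw]]; have : exists2 b, dequiv w (DT b) & qbasis QBit b.
  case: iw => -[d [hd hE]]; [exists ttrue; last by left|exists tfalse; last by right];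
  by apply: deq_trans hE _; apply: dequiv_dmap hd.
by move=> [b hb qb]; exists b => //; apply: evals_trans hw (evals_equiv hb).
Qed.

Lemma evals_branch vs t :  cvals vs ->
  evals (substD 0 Unit (instD 1 vs (DT (Seq (Var 0) (DT t))))) (DT (instT 0 (Unit :: vs) t)).
Proof.
move=> hvs; rewrite (proj2 (subst_inst Unit hvs)) /=.
by apply: evals_red1; apply: r_seq.
Qed.

Lemma semC_if D t r s A : semC D t CBit -> semC D r A -> semC D s A -> semC D (SIf t r s) A.
Proof.
move=> IHt IHr IHs e vs hvs hD.
have hvs' : cvals (Unit :: vs) by apply: cvals_cons.
have [b hb [E|E]] := realizes_bit (IHt e vs hvs hD); subst b.
  apply: evals_realizes (IHr (None :: e) (Unit :: vs) hvs' hD).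
  apply: evals_trans (evals_frame1 (frame_match _ _) hb) _.
  by apply: evals_trans (evals_branch _ hvs); apply: evals_red1; apply: r_inl.
apply: evals_realizes (IHs (None :: e) (Unit :: vs) hvs' hD).
apply: evals_trans (evals_frame1 (frame_match _ _) hb) _.
by apply: evals_trans (evals_branch _ hvs); apply: evals_red1; apply: r_inr.
Qed.

Lemma agree_refl xs e vs : agree xs e vs vs.
Proof. by []. Qed.

(** The translated abstraction is a combination with one summand of coefficient 1. By the hypothesis
    on the body, distinct basis arguments have orthonormal images, which is what [iso_realizes]
    needs. *)
Lemma semC_lamQ D x A B t : ~ In x (names D) -> semQ D ((x, A) :: nil) t B ->
  semC D (SLamQ x t) (CLoll A B).
Proof.
move=> nx IH e vs hvs hD; have hvs' : cvals (Unit :: vs) by apply: cvals_cons.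
set body := DT (tr (Some x :: None :: e) t).
exists (DT (tm e vs (SLamQ x t))); split; first exact: evals_refl.
exists (DT (instT 1 vs (Lam body))); split; first exact: deq_refl.
split; first exact: (closed_instT (Lam (DT (Lam body))) hvs).
apply: (@realizes_lsubst_pure CUnit) => v _ _ iv.
have {iv} -> : v = Unit by have [] := leaves_equiv iv v; case=> //; left.
rewrite lsubst_inst //.
exists (DT (instT 0 (Unit :: vs) (Lam body))); split; first exact: evals_refl.
exists (1%R, instD 1 (Unit :: vs) body), nil; split; first exact: deq_sym (deq_one _).
split; first by move=> p [<-|[]]; exact: (closed_instT (Lam body) hvs').
split; first by apply/sphereP; rewrite ip_DTid.
move=> u hu; apply: evals_realizes; first by apply: evals_equiv; exact: deq_one.
have okv c : qbasis A c -> [/\ cvals (c :: Unit :: vs),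
    okC D (Some x :: None :: e) (c :: Unit :: vs) &
    okQ ((x, A) :: nil) (Some x :: None :: e) (c :: Unit :: vs)].
  by move=> qc; have [h1 h2] := qbasis_cval qc; split;
    [apply: cvals_cons|apply: okC_there|apply: okQ_here].
rewrite lsubst_inst //; apply: iso_realizes hu => [b qb|b b' qb qb'].
  by have [h1 h2 h3] := okv _ qb; case: (IH _ _ h1 h2 h3).
have [h1 h2 h3] := okv _ qb; have [h1' _ h3'] := okv _ qb'.
have [_ /(_ _ h1' _ h3') ->] := IH _ _ h1 h2 h3; last exact/agree_there.
by apply: ind_iff; rewrite agree_cons !lookup_here; split=> [[]//|->]; split.
Qed.

Lemma semQ_var D x A : semQ D ((x, A) :: nil) (SVar x) A.
Proof.
move=> e vs hvs hD hG; have tmE us : tm e us (SVar x) = lookup e us x.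
  by rewrite /tm /= subn0.
have okx us : okQ ((x, A) :: nil) e us -> qbasis A (lookup e us x) by apply; left.
rewrite tmE; have [hb E] := NF_basis (okx _ hG); split=> // vs' hvs' _ hG'.
have [_ E'] := NF_basis (okx _ hG'); rewrite tmE (ip_equiv E E') ip_DT.
by apply: ind_iff; rewrite agree_cons; split=> [->|[]//]; split.
Qed.

Lemma okQ_perm (G G1 G2 : list (nat * qtype)) e vs : Permutation G (G1 ++ G2) ->
  okQ G e vs -> okQ G1 e vs /\ okQ G2 e vs.
Proof.
move=> /Permutation_sym hG h; split=> x A hx; apply: h;
apply: Permutation_in hG _; apply/in_app_iff; by [left|right].
Qed.

(** Splitting the context factors the indicator. The right component is evaluated first, so
    [iso_bind] is applied to [t], with the inner product of the left components as factor, and then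
    to [s], with factor [ind (p = p')]. *)
Lemma semQ_tens D G G1 G2 s t A B : semQ D G1 s A -> semQ D G2 t B ->
  Permutation G (G1 ++ G2) -> semQ D G (STens s t) (QTens A B).
Proof.
move=> IHs IHt hG e vs hvs hD hGv; have [hG1 hG2] := okQ_perm hG hGv.
have [bs ips] := IHs _ _ hvs hD hG1; have [bt ipt] := IHt _ _ hvs hD hG2.
have pairv q p : qbasis A q -> qbasis B p -> qbasis (QTens A B) (Pair q p).
  by move=> ? ?; exists q, p.
have bpair us p : bev A (DT (tm e us s)) -> qbasis B p ->
    bev (QTens A B) (DT (Pair (tm e us s) p)).
  move=> bu qp; have [_ vp] := qbasis_cval qp.
  apply: (proj1 (bev_bind (frame_pairL vp) bu _)) => q qq.
  by case: (NF_basis (pairv _ _ qq qp)).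
split.
  by apply: (proj1 (bev_bind (frame_pairR (tm e vs s)) bt _)) => p; apply: bpair.
move=> vs' hvs' hDD hGv'; have [hG1' hG2'] := okQ_perm hG hGv'.
have hD' := okC_agree hDD hD.
have [bs' _] := IHs _ _ hvs' hD' hG1'; have [bt' _] := IHt _ _ hvs' hD' hG2'.
rewrite (ind_iff (agree_perm e vs vs' hG)) ind_and -ips // -ipt //.
apply: (iso_bind (K := Pair (tm e vs s)) (K' := Pair (tm e vs' s)) _ _ bt bt').
- exact: frame_pairR.
- exact: frame_pairR.
- by move=> p; apply: bpair.
- by move=> p; apply: bpair.
move=> p p' qp qp'; have [_ vp] := qbasis_cval qp; have [_ vp'] := qbasis_cval qp'.
rewrite mulrC.
apply: (iso_bind (K := Pair^~ p) (K' := Pair^~ p') (B := QTens A B) _ _ bs bs').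
- exact: frame_pairL.
- exact: frame_pairL.
- by move=> q qq; case: (NF_basis (pairv _ _ qq qp)).
- by move=> q qq; case: (NF_basis (pairv _ _ qq qp')).
move=> q q' qq qq'; have [_ E] := NF_basis (pairv _ _ qq qp).
have [_ E'] := NF_basis (pairv _ _ qq' qp').
by rewrite (ip_equiv E E') ip_DT -ind_and; apply: ind_iff; split=> [[-> ->]|[-> ->]].
Qed.

Lemma semQ_gate D G U t : semQ D G t QBit -> semQ D G (SGate U t) QBit.
Proof.
move=> IH e vs hvs hD hG; have [bt ipt] := IH _ _ hvs hD hG.
have [g1 g2] := gate_iso U.
split; first by apply: (proj1 (bev_bind (frame_appR (Ubar U)) bt _)).
move=> vs' hvs' hDD hG'; have [bt' _] := IH _ _ hvs' (okC_agree hDD hD) hG'.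
rewrite -ipt // -[RHS]mul1r.
apply: (iso_bind (K := App (Ubar U)) (K' := App (Ubar U)) _ _ bt bt' g1 g1).
- exact: frame_appR.
- exact: frame_appR.
by move=> p p' qp qp'; rewrite mul1r g2.
Qed.

(** On each basis pair produced by [s] the construct becomes its body under an extended assignment.
    Agreement of two such assignments splits into equality of the pairs and agreement on [G2], the
    latter being the factor for [iso_bind]; linearity takes care of entangled pairs. *)
Lemma semQ_let D G G1 G2 x y s t A B C' :
  ~ In x (names D) -> ~ In y (names D) -> x <> y ->
  ~ In x (names G2) -> ~ In y (names G2) ->
  semQ D G1 s (QTens A B) -> semQ D ((x, A) :: (y, B) :: G2) t C' ->
  Permutation G (G1 ++ G2) -> semQ D G (SLetT x y s t) C'.
Proof.
move=> nxD nyD nxy nxG nyG IHs IHt hG e vs hvs hD hGv; have [hG1 hG2] := okQ_perm hG hGv.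
have [bs ips] := IHs _ _ hvs hD hG1.
(* The second component has index 0, so [y] comes first. *)
pose e' := Some y :: Some x :: e.
pose K us p := Let p (DT (instT 2 us (tr e' t))).
have okv us c c' : cvals us -> okC D e us -> okQ G2 e us -> qbasis A c -> qbasis B c' ->
    [/\ cvals (c' :: c :: us), okC D e' (c' :: c :: us) &
        okQ ((x, A) :: (y, B) :: G2) e' (c' :: c :: us)].
  move=> hus hDu hGu qc qc'; have [h1 h2] := qbasis_cval qc; have [h3 h4] := qbasis_cval qc'.
  split; first by do 2!apply: cvals_cons => //.
    by do 2!apply: okC_there => //.
  move=> z T [[<- <-]|[[<- <-]|hz]].
  - by rewrite lookup_there // lookup_here.
  - by rewrite lookup_here.
  - by apply: okQ_there hz => //; apply: okQ_there.
have hK us p : cvals us -> okC D e us -> okQ G2 e us -> qbasis (QTens A B) p ->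
    exists c c', [/\ p = Pair c c', qbasis A c, qbasis B c', bev C' (DT (K us p)) &
      dequiv (NF (DT (K us p))) (NF (DT (tm e' (c' :: c :: us) t)))].
  move=> hus hDu hGu [c [c' [-> qc qc']]]; exists c, c'.
  have [h1 h2 h3] := okv _ _ _ hus hDu hGu qc qc'.
  have [bc _] := IHt _ _ h1 h2 h3.
  have [_ v1] := qbasis_cval qc; have [c2 v2] := qbasis_cval qc'.
  by have [? ?] := NF_evals (evals_let (tr e' t) hus c2 v1 v2) bc.
have bK us : cvals us -> okC D e us -> okQ G2 e us ->
    forall p, qbasis (QTens A B) p -> bev C' (DT (K us p)).
  by move=> hus hDu hGu p /(hK _ _ hus hDu hGu)[c [c' []]].
split; first by apply: (proj1 (bev_bind (frame_let _) bs (bK _ hvs hD hG2))).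
move=> vs' hvs' hDD hGv'; have [hG1' hG2'] := okQ_perm hG hGv'.
have hD' := okC_agree hDD hD; have [bs' _] := IHs _ _ hvs' hD' hG1'.
rewrite (ind_iff (agree_perm e vs vs' hG)) ind_and -ips // mulrC.
apply: (iso_bind (K := K vs) (K' := K vs') _ _ bs bs' (bK _ hvs hD hG2) (bK _ hvs' hD' hG2')).
- exact: frame_let.
- exact: frame_let.
move=> p p' /(hK _ _ hvs hD hG2)[c [d [-> qc qd _ E]]].
move=> /(hK _ _ hvs' hD' hG2')[c' [d' [-> qc' qd' _ E']]]; rewrite (ip_equiv E E').
have [h1 h2 h3] := okv _ _ _ hvs hD hG2 qc qd.
have [h1' h2' h3'] := okv _ _ _ hvs' hD' hG2' qc' qd'.
have [_ /(_ _ h1' _ h3') ->] := IHt _ _ h1 h2 h3; last by do 2!apply/agree_there => //.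
rewrite -ind_and; apply: ind_iff; rewrite /= !agree_cons.
rewrite !(lookup_there _ _ _ nxy) !lookup_here !agree_there //.
by split=> [[-> [-> ?]]|[? [-> ->]]].
Qed.

(** A classical term depends on classical variables only, so both assignments yield the very same
    term, and any two assignments agree on an empty quantum context. *)
Lemma semQ_new D t : semC D t CBit -> (forall x, In x (sfv t) -> In x (names D)) ->
  semQ D nil (SNew t) QBit.
Proof.
move=> IH hfv e vs hvs hD _; have [b hb qb] := realizes_bit (IH _ _ hvs hD).
have q : qvec QBit (DT b) by move=> u [<-|[]].
split; first by exists (DT b).
move=> vs' hvs' hDD _; have E := NF_unique hb (qvec_vals q).
have -> : tm e vs' (SNew t) = tm e vs t.
  by apply/esym; apply: instT_agree => x /hfv /hDD.
by rewrite (ip_equiv E E) ip_DTid ind_true.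
Qed.

Lemma semQ_appQ D G s t A B : semC D s (CLoll A B) ->
  (forall x, In x (sfv s) -> In x (names D)) ->
  semQ D G t A -> semQ D G (SAppQ s t) B.
Proof.
move=> IHs hfv IHt e vs hvs hD hG; have [bt ipt] := IHt _ _ hvs hD hG.
have [s1 s2] := appQ_iso (IHs _ _ hvs hD).
split; first exact: (proj1 (bev_bind (frame_appR _) bt s1)).
move=> vs' hvs' hDD hG'; have [bt' _] := IHt _ _ hvs' (okC_agree hDD hD) hG'.
have -> : tm e vs' (SAppQ s t) = App (App (tm e vs s) Unit) (tm e vs' t).
  congr (App (App _ _) _); apply/esym; apply: instT_agree => x /hfv; exact: hDD.
rewrite -ipt // -[RHS]mul1r.
apply: (iso_bind (K := App (App (tm e vs s) Unit)) (K' := App (App (tm e vs s) Unit))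
          _ _ bt bt' s1 s1).
- exact: frame_appR.
- exact: frame_appR.
by move=> p p' qp qp'; rewrite mul1r s2.
Qed.

Lemma soundness :
  (forall D t A, ctyping D t A -> semC D t A) /\
  (forall D G t A, qtyping D G t A -> semQ D G t A).
Proof.
apply: typing_ind.
- move=> D x A hx e vs hvs hD; exists (DT (lookup e vs x)); split; last exact: hD.
  by rewrite /tm /= subn0; exact: evals_refl.
- by move=> D e vs _ _; exists (DT Unit); split; [exact: evals_refl|exact: deq_refl].
- by move=> D x A B t nx _; exact: semC_lam.
- by move=> D t r A B _ IHt _; exact: semC_app IHt.
- by move=> D t r A B _ IHt _; exact: semC_pair IHt.
- by move=> D t A B _; exact: semC_pi1.
- by move=> D t A B _; exact: semC_pi2.
- move=> D e vs _ _; exists (DT ttrue); split; first exact: evals_refl.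
  by left; exists (DT Unit); split; exact: deq_refl.
- move=> D e vs _ _; exists (DT tfalse); split; first exact: evals_refl.
  by right; exists (DT Unit); split; exact: deq_refl.
- by move=> D t r s A _ IHt _ IHr _; exact: semC_if IHt IHr.
- by move=> D x A B t nx _; exact: semC_lamQ.
- exact: semQ_var.
- by move=> D G G1 G2 s t A B _ IHs _; exact: semQ_tens.
- by move=> D G U t _; exact: semQ_gate.
- by move=> D G G1 G2 x y s t A B C' ? ? ? ? ? _ IHs _ IHt; exact: semQ_let IHs IHt.
- by move=> D t ht IH; apply: semQ_new IH (proj1 typing_sfv _ _ _ ht).
- by move=> D G s t A B hs IHs _; apply: semQ_appQ IHs (proj1 typing_sfv _ _ _ hs).
Qed.

(** * Validity of the translated judgments *)

Lemma idx_In (T : Type) (E : list (nat * T)) (d : T) x A : NoDup (names E) -> In (x, A) E ->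
  idx (envOf E) x < length E /\ List.nth (idx (envOf E) x) (map snd E) d = A.
Proof.
elim: E => [|[y B] E IH] //= /NoDup_cons_iff[ny nd] [[-> ->]|hx]; first by rewrite eqxx.
rewrite -/(idx (Some y :: envOf E) x) idx_there ?ltnS; first exact: IH.
by move=> exy; apply: ny; rewrite -exy; exact: In_names hx.
Qed.

Lemma In_idx (T : Type) (E : list (nat * T)) i : NoDup (names E) -> i < length E ->
  exists x A, In (x, A) E /\ idx (envOf E) x = i.
Proof.
elim: E i => [|[y B] E IH] [|i] //= /NoDup_cons_iff[ny nd] hi.
  by exists y, B; split; [left|rewrite eqxx].
have [x [A [hx <-]]] := IH i nd hi; exists x, A; split; first by right.
apply: (@idx_there (envOf E)) => exy; apply: ny; rewrite -exy; exact: In_names hx.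
Qed.

Lemma idx_names (T : Type) (E : list (nat * T)) x :
  In x (names E) -> idx (envOf E) x < length E.
Proof.
elim: E => [|[y B] E IH] //= [->|/IH]; first by rewrite eqxx.
by case: eqP.
Qed.

(** * Closing substitutions of a translated context *)

Section Contexts.
Variables (D : list (nat * ctype)) (G : list (nat * qtype)).

Definition tctx : list (nat * ttype) :=
  (map (fun p => (p.1, trC p.2)) D ++ map (fun p => (p.1, trQ p.2)) G)%list.

Lemma names_tctx : names tctx = (names D ++ names G)%list.
Proof. by rewrite /names map_app !map_map. Qed.

Lemma types_tctx : map snd tctx =
  (map (fun p => trC (snd p)) D ++ map (fun p => trQ (snd p)) G)%list.
Proof. by rewrite map_app !map_map. Qed.

Lemma envOf_tctx : envOf tctx = (envOf D ++ envOf G)%list.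
Proof. by rewrite /envOf map_app !map_map. Qed.

Lemma In_tctx x T : In (x, T) tctx <->
  (exists2 A, T = trC A & In (x, A) D) \/ (exists2 A, T = trQ A & In (x, A) G).
Proof.
rewrite in_app_iff !in_map_iff; split.
  by move=> [] [[y A] [[<- <-] h]]; [left|right]; exists A.
by move=> [] [A -> h]; [left|right]; exists (x, A).
Qed.

Hypothesis nd : NoDup (names D ++ names G).
Let e := (envOf D ++ envOf G)%list.
Let Ts := (map (fun p => trC (snd p)) D ++ map (fun p => trQ (snd p)) G)%list.

Lemma idx_tctx x T : In (x, T) tctx -> idx e x < length Ts /\ List.nth (idx e x) Ts TU = T.
Proof.
rewrite /e /Ts -envOf_tctx -types_tctx length_map => hx.
by apply: idx_In hx; rewrite names_tctx.
Qed.

Lemma tctx_idx i : i < length Ts -> exists x T, In (x, T) tctx /\ idx e x = i.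
Proof.
rewrite /Ts /e -envOf_tctx -types_tctx length_map.
by apply: In_idx; rewrite names_tctx.
Qed.

Lemma occ_tctx_bound t i :
  (forall x, In x (sfv t) -> In x (names D) \/ In x (names G)) ->
  occT i (tr e t) -> i < length Ts.
Proof.
move=> h /occ_tr[x [/h hx <-]]; rewrite /Ts /e -envOf_tctx -types_tctx length_map.
by apply: idx_names; rewrite names_tctx in_app_iff.
Qed.

(** By [trC_flat] such an index is not classical, so it belongs to a quantum variable, and those all
    occur. *)
Lemma occ_tctx_sharp t i : (forall x, In x (names G) -> In x (sfv t)) -> i < length Ts ->
  ~ (forall d, interp (List.nth i Ts TU) d <-> interp (TFlat (List.nth i Ts TU)) d) ->
  occT i (tr e t).
Proof.
move=> h hi ns; have [x [T [hx ei]]] := tctx_idx hi; have [_ E] := idx_tctx hx.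
rewrite ei in E; apply/occ_tr; exists x; split=> //; apply: h.
case/In_tctx: hx => -[A ET hx]; last exact: In_names hx.
by case: ns => d; rewrite E ET; exact: trC_flat.
Qed.

Variable ws : list dist.
Hypothesis hlen : length ws = length Ts.
Hypothesis hws : forall i, i < length Ts -> interp (List.nth i Ts TU) (List.nth i ws (DT Unit)).

Lemma selects_nth vs i : selects vs ws -> In (vnth vs i) (leaves (List.nth i ws (DT Unit))).
Proof.
move=> h; rewrite /vnth; elim: h i => [|v w vs' ws' hv _ IH] [|i] //=; by left.
Qed.

Lemma selects_cvals vs : selects vs ws -> cvals vs.
Proof.
move=> hs v /(In_nth _ _ Unit)[i [hi <-]].
have hi' : i < length Ts by rewrite -hlen -(Forall2_length hs); apply/ltP.
exact: interp_cval (hws hi') (selects_nth i hs).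
Qed.

Lemma selects_okC vs : selects vs ws -> okC D e vs.
Proof.
move=> hs x A hx; have hx' : In (x, trC A) tctx by apply/In_tctx; left; exists A.
have [hi E] := idx_tctx hx'; have := hws hi; rewrite E => hw.
have [v hv] := trC_pure hw; have := selects_nth (idx e x) hs.
move=> /(leaves_equiv hv) [Ev|[]]; rewrite /lookup -Ev; exact: interp_equiv hv hw.
Qed.

Lemma selects_okQ vs : selects vs ws -> okQ G e vs.
Proof.
move=> hs x A hx; have hx' : In (x, trQ A) tctx by apply/In_tctx; right; exists A.
have [hi E] := idx_tctx hx'; have := hws hi; rewrite E => /interp_trQ[hw _].
by apply: hw; exact: selects_nth.
Qed.

Lemma selects_agree vs vs' : selects vs ws -> selects vs' ws -> agree (names D) e vs vs'.
Proof.
move=> hs hs' x /in_map_iff[[y A] [/= -> hx]].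
have hx' : In (x, trC A) tctx by apply/In_tctx; left; exists A.
have [hi E] := idx_tctx hx'; have := hws hi; rewrite E => /trC_pure[v hv].
have := selects_nth (idx e x) hs; have := selects_nth (idx e x) hs'.
by move=> /(leaves_equiv hv) [Ev|[]] /(leaves_equiv hv) [Ev'|[]]; rewrite /lookup -Ev -Ev'.
Qed.

(** A classical entry has a single possible leaf, so a selection is determined by its quantum part;
    this matches the indicator of [semQ] with that of [ip_mexp]. *)
Lemma selects_eq vs vs' : selects vs ws -> selects vs' ws ->
  agree (names G) e vs vs' <-> vs = vs'.
Proof.
move=> hs hs'; split=> [h|->]; last exact: agree_refl.
have hD := selects_agree hs hs'.
apply: (@nth_ext _ _ _ Unit Unit); first by rewrite (Forall2_length hs) (Forall2_length hs').
move=> i /ltP; rewrite (Forall2_length hs) hlen => hi.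
have [x [T [hx <-]]] := tctx_idx hi.
by case/In_tctx: hx => -[A _ hx]; [apply: hD|apply: h]; exact: In_names hx.
Qed.

Lemma ctx_unit w : In w ws -> ip w w = 1%R.
Proof.
move=> /(In_nth _ _ (DT Unit))[i [/ltP hi <-]]; rewrite hlen in hi.
have [x [T [hx ei]]] := tctx_idx hi; have [_ E] := idx_tctx hx.
have := hws hi; rewrite -[in List.nth i Ts _]ei E.
case/In_tctx: hx => -[A -> _]; last by case/interp_trQ.
by move=> /trC_pure[v hv]; rewrite (ip_equiv hv hv) ip_DTid.
Qed.

Lemma selects_close vs t : selects vs ws ->
  (forall x, In x (sfv t) -> In x (names D) \/ In x (names G)) ->
  close (DT (tr e t)) (map DT vs) = DT (tm e vs t).
Proof.
move=> hs ht; apply: close_DT; first exact: selects_cvals.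
by move=> n hn; rewrite (Forall2_length hs) hlen; exact: occ_tctx_bound hn.
Qed.

End Contexts.

(** The substitution is expanded over selections of leaves and every summand is evaluated; the norm
    of the combined normal forms is given by [ip_mexp] with factor 1. *)
Lemma close_quantum D G t A ws :
  let Ts := (map (fun p => trC (snd p)) D ++ map (fun p => trQ (snd p)) G)%list in
  NoDup (names D ++ names G) -> qtyping D G t A -> length ws = length Ts ->
  (forall i, i < length Ts -> interp (List.nth i Ts TU) (List.nth i ws (DT Unit))) ->
  realizes (close (DT (tr (envOf D ++ envOf G)%list t)) ws) (interp (trQ A)).
Proof.
move=> Ts nd ht hlen hws; set e := (envOf D ++ envOf G)%list.
have [hfv _] := proj2 typing_sfv _ _ _ _ ht; have sem := proj2 soundness _ _ _ _ ht.
have sel vs : selects vs ws -> [/\ cvals vs, okC D e vs & okQ G e vs].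
  by move=> hs; split;
    [exact: (selects_cvals hlen hws hs)|exact: (selects_okC nd hws hs)|
     exact: (selects_okQ nd hws hs)].
have bv vs : selects vs ws -> bev A (DT (tm e vs t)).
  by move=> /sel[h1 h2 h3]; case: (sem _ _ h1 h2 h3).
exists (mexp ws (fun vs => NF (DT (tm e vs t)))); split.
  apply: evals_trans (evals_equiv (close_mexp _ _)) _; apply: evals_mexp => vs hs.
  by rewrite (selects_close hlen hws hs hfv); case: (bev_NF (bv _ hs)).
apply/interp_trQ; split; first by move=> u /leaves_mexp[vs /bv/bev_NF[_ h]] /h.
apply: ip_mexp => [w|vs vs' hs hs']; first exact: (ctx_unit nd hlen hws).
have [h1 h2 h3] := sel _ hs; have [h1' _ h3'] := sel _ hs'.
have [_ /(_ _ h1' _ h3') ->] := sem _ _ h1 h2 h3; last exact: (selects_agree nd hws hs hs').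
by rewrite mul1r; apply: ind_iff; exact: (selects_eq nd hlen hws hs hs').
Qed.

Lemma close_pure d ws vs : Forall2 (fun w v => dequiv w (DT v)) ws vs ->
  dequiv (close d ws) (close d (map DT vs)).
Proof.
move=> h; elim: h d => [|w v ws' vs' hwv _ IH] d; first exact: deq_refl.
apply: deq_trans (IH (lsubst d w)) _; apply: close_equiv; exact: (dequiv_dmap _ hwv).
Qed.

(** Every entry is congruent to one value, so a single selection suffices. The results on mixed
    contexts are reused with an empty quantum part. *)
Lemma close_classical D t A ws :
  let Ts := map (fun p => trC (snd p)) D in
  NoDup (names D) -> ctyping D t A -> length ws = length Ts ->
  (forall i, i < length Ts -> interp (List.nth i Ts TU) (List.nth i ws (DT Unit))) ->
  realizes (close (DT (tr (envOf D) t)) ws) (interp (trC A)).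
Proof.
move=> Ts nd ht hlen hws.
have nd' : NoDup (names D ++ @names qtype nil) by rewrite cats0.
have TsE : (Ts ++ map (fun p : nat * qtype => trQ (snd p)) nil)%list = Ts.
  by rewrite /= app_nil_r.
have hlen' : length ws = length (Ts ++ map (fun p : nat * qtype => trQ (snd p)) nil)%list.
  by rewrite TsE.
have hws' i : i < length (Ts ++ map (fun p : nat * qtype => trQ (snd p)) nil)%list ->
    interp (List.nth i (Ts ++ map (fun p : nat * qtype => trQ (snd p)) nil)%list TU)
      (List.nth i ws (DT Unit)).
  by rewrite TsE; exact: hws.
have hfv x : In x (sfv t) -> In x (names D) \/ In x (@names qtype nil).
  by move=> /(proj1 typing_sfv _ _ _ ht); left.
have [vs hvs] : exists vs, Forall2 (fun w v => dequiv w (DT v)) ws vs.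
  have : forall w, In w ws -> exists v, dequiv w (DT v).
    move=> w /(In_nth _ _ (DT Unit))[i [/ltP hi <-]]; rewrite hlen in hi.
    have := hws i hi; rewrite length_map in hi.
    (* Writing the default [TU] as [trC CUnit] gives the form expected by [map_nth]. *)
    rewrite (nth_indep _ TU (trC CUnit)) ?length_map; last exact/ltP.
    rewrite -/(trC CUnit) /Ts -(map_map snd trC) map_nth; exact: trC_pure.
  elim: (ws) => [|w ws' IH] h; first by exists nil.
  have [v hv] := h w (or_introl erefl).
  by have [|vs hvs] := IH; [move=> u hu; apply: h; right|exists (v :: vs); constructor].
have hs : selects vs ws.
  by elim: hvs => [|w v ws' vs' hwv _ IH]; constructor=> //; apply/(leaves_equiv hwv); left.
apply: evals_realizes (proj1 soundness _ _ _ ht (envOf D) vs _ _).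
- apply: evals_equiv; move: (selects_close hlen' hws' hs hfv); rewrite /= app_nil_r => <-.
  exact: close_pure.
- exact: (selects_cvals hlen' hws' hs).
- by have := selects_okC nd' hws' hs; rewrite /= app_nil_r.
Qed.

(** * Programs on arbitrary states *)

Lemma In_mem (x : nat) (s : list nat) : In x s <-> x \in s.
Proof.
elim: s => [|y s IH] //=; rewrite seq.in_cons IH.
by split=> [[->|->]|/orP[/eqP->|]]; rewrite ?eqxx ?orbT; auto.
Qed.

Lemma uniq_NoDup (s : list nat) : uniq s -> NoDup s.
Proof.
elim: s => [|x s IH] => [_|/= /andP[hx /IH hs]]; first by constructor.
by constructor=> // /In_mem; apply/negP.
Qed.

Lemma nth_seqE (T : Type) (d : T) s i : List.nth i s d = seq.nth d s i.
Proof. by elim: s i => [|x s IH] [|i] //=. Qed.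

Lemma occD_leaves n d : occD n d -> exists2 t, In t (leaves d) & occT n t.
Proof.
elim: d => [t h|a d IH|d IHd e IHe] //=; first by exists t => //; left.
by move=> /orP[/IHd|/IHe] [t ht hn]; exists t => //; apply/in_app_iff; [left|right].
Qed.

(** A formal sum may list the same basis state several times; the double sum groups such entries
    into one amplitude. *)
Lemma sum_state_vec n (L : list (C * ket n)) :
  (\sum_(p <- L) \sum_(q <- L) p.1^* * q.1 * (p.2 == q.2)%:R =
   \sum_(y : ket n) `|state_vec L y| ^+ 2)%R.
Proof.
transitivity (\sum_(y : ket n) \sum_(p <- L | p.2 == y) p.1^* * state_vec L y)%R; last first.
  by apply: eq_bigr => y _; rewrite normCK mulrC {1}/state_vec rmorph_sum mulr_suml.
rewrite [RHS](exchange_big_dep xpredT) //=; apply: eq_bigr => p _.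
rewrite (big_pred1 p.2) => [|y]; last by rewrite /= eq_sym.
rewrite /state_vec mulr_sumr [RHS]big_mkcond; apply: eq_bigr => q _ /=.
by rewrite [p.2 == _]eq_sym; case: eqP; rewrite ?mulr1 ?mulr0.
Qed.

Section Programs.
Variables (n : nat) (xs : n.-tuple nat) (t : sterm) (A : qtype).
Let G := [seq (x, QBit) | x <- xs].
Let e : env := map Some xs.
Hypothesis xs_uniq : uniq xs.
Hypothesis t_typed : qtyping nil G t A.

Definition ket_vals (y : ket n) : list term := [seq bitval (y k) | k <- enum 'I_n].

Lemma names_bits : names G = xs.
Proof. by rewrite /names /G; elim: (tval xs) => //= x s ->. Qed.

Lemma envOf_bits : envOf G = e.
Proof. by rewrite /envOf /G /e; elim: (tval xs) => //= x s ->. Qed.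

Lemma length_ket_vals y : length (ket_vals y) = n.
Proof. by rewrite -[length _]/(size _) size_map size_enum_ord. Qed.

Lemma length_bits : length G = n.
Proof. by rewrite -[length _]/(size _) size_map size_tuple. Qed.

Lemma ket_vals_basis y v : In v (ket_vals y) -> qbasis QBit v.
Proof.
rewrite /ket_vals; elim: (enum _) => [|k s IH] //= [<-|/IH//].
by case: (y k); [right|left].
Qed.

Lemma cvals_ket y : cvals (ket_vals y).
Proof. by move=> v /ket_vals_basis /qbasis_cval. Qed.

Lemma okQ_ket y : okQ G e (ket_vals y).
Proof.
move=> x B hx; have -> : B = QBit.
  by move: hx; rewrite /G; elim: (tval xs) => //= z s IH [[_ ->]|/IH].
apply: (@ket_vals_basis y); apply: nth_In; apply/ltP; rewrite length_ket_vals -envOf_bits.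
by rewrite -[ltnRHS]length_bits; apply: idx_names; exact: In_names hx.
Qed.

Lemma agree_ket y y' : agree (names G) e (ket_vals y) (ket_vals y') <-> y = y'.
Proof.
split=> [h|->]; last exact: agree_refl.
apply/ffunP => k; have [||x [B [hx ik]]] := @In_idx _ G k.
- by rewrite names_bits; apply: uniq_NoDup.
- by rewrite length_bits.
have nthk z : vnth (ket_vals z) k = bitval (z k).
  by rewrite /vnth nth_seqE (nth_map k) ?size_enum_ord // nth_ord_enum.
have := h x (In_names hx); rewrite /lookup -envOf_bits ik !nthk.
by case: (y k); case: (y' k).
Qed.

Lemma close_ket (y : ket n) :
  close (DT (tr e t)) [seq DT (bitval (y k)) | k <- enum 'I_n] = DT (tm e (ket_vals y) t).
Proof.
rewrite -close_DT; first by rewrite -[map DT _]/(seq.map DT _) /ket_vals -map_comp.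
  exact: cvals_ket.
move=> i /occ_tr[x [hx <-]]; rewrite length_ket_vals -envOf_bits -[ltnRHS]length_bits.
by apply: idx_names; have [/(_ x hx)[]] := proj2 typing_sfv _ _ _ _ t_typed.
Qed.

Lemma tr_progE h kets : tr_prog h kets xs t =
  lcomb (h.1, DT (tm e (ket_vals h.2) t))
        (map (fun p => (p.1, DT (tm e (ket_vals p.2) t))) kets).
Proof.
rewrite /tr_prog -/e close_ket; congr lcomb; apply: map_ext => p.
by rewrite close_ket.
Qed.

Lemma ket_iso : (forall y, bev A (DT (tm e (ket_vals y) t))) /\
  forall y y', ip (NF (DT (tm e (ket_vals y) t))) (NF (DT (tm e (ket_vals y') t))) =
               (y == y')%:R%R.
Proof.
have sem (y : ket n) := proj2 soundness _ _ _ _ t_typed e _ (@cvals_ket y) (fun _ _ => False_ind _)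
  (@okQ_ket y).
split=> [y|y y']; first by case: (sem y).
have [_ ->] := sem y; [|exact: cvals_ket|by []|exact: okQ_ket].
rewrite (ind_iff (agree_ket y y')); case: eqP => h; by [rewrite ind_true|rewrite ind_false].
Qed.

(** An entangled state is not a substitution of one vector per variable, so [close_quantum] does not
    apply. The state is expanded on basis states instead, and orthonormality of their images carries
    its norm over to the result. *)
Lemma realizes_prog (h : C * ket n) kets :
  (\sum_(y : ket n) `|state_vec (h :: kets) y| ^+ 2)%R = 1%R ->
  realizes (tr_prog h kets xs t) (interp (trQ A)).
Proof.
move=> nQ; rewrite tr_progE; have [hb ho] := ket_iso.
pose W y := NF (DT (tm e (ket_vals y) t)).
exists (lcomb (h.1, W h.2) (map (fun p => (p.1, W p.2)) kets)); split.
  apply: (@evals_lcomb _ h kets (fun y => DT (tm e (ket_vals y) t)) W) => y.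
  by case: (bev_NF (hb y)).
have consE : (h.1, W h.2) :: map (fun p => (p.1, W p.2)) kets =
    [seq (p.1, W p.2) | p <- h :: kets] by [].
apply/interp_trQ; split.
  move=> u /leaves_lcomb[p].
  rewrite -[_ :: _]/(map (fun p => (p.1, W p.2)) (h :: kets)) => /in_map_iff[q [<- _]] /=.
  by case: (bev_NF (hb q.2)) => _ q' /q'.
rewrite ip_lcomb consE big_map -nQ -sum_state_vec; apply: eq_bigr => p _.
by rewrite big_map; apply: eq_bigr => q _; rewrite ho.
Qed.

Lemma closed_prog (h : C * ket n) kets i : occD i (tr_prog h kets xs t) = false.
Proof.
apply/negP => /occD_leaves[u]; rewrite tr_progE => /leaves_lcomb[p].
rewrite -[_ :: _]/(map (fun p => (p.1, DT (tm e (ket_vals p.2) t))) (h :: kets)).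
move=> /in_map_iff[q [<- _]] [<-|[]].
by rewrite /= (closed_instT (tr e t) (@cvals_ket q.2) i).
Qed.

End Programs.

Theorem theorem4 :
  (* (1) quantum judgments *)
  (forall (D : list (nat * ctype)) (G : list (nat * qtype)) (t : sterm) (AQ : qtype),
     NoDup (names D ++ names G) ->
     qtyping D G t AQ ->
     valid (map (fun p => trC (snd p)) D ++ map (fun p => trQ (snd p)) G)
           (DT (tr (envOf D ++ envOf G) t)) (trQ AQ)) /\
  (* (2) classical judgments *)
  (forall (D : list (nat * ctype)) (t : sterm) (A : ctype),
     NoDup (names D) ->
     ctyping D t A ->
     valid (map (fun p => trC (snd p)) D) (DT (tr (envOf D) t)) (trC A)) /\
  (* (3) well-typed programs *)
  (forall (n : nat) (h : C * ket n) (kets : list (C * ket n)) (xs : n.-tuple nat)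
          (t : sterm) (AQ : qtype),
     (\sum_(y : ket n) `|state_vec (h :: kets) y| ^+ 2)%R = 1%R ->
     uniq xs ->
     (forall x, In x (sfv t) <-> x \in xs) ->
     qtyping nil [seq (x, QBit) | x <- xs] t AQ ->
     valid nil (tr_prog h kets xs t) (trQ AQ)).
Proof.
split; last split.
- move=> D G t A nd ht; have [fv1 fv2] := proj2 typing_sfv _ _ _ _ ht; split; last split.
  + by move=> i hi ns; exact: (occ_tctx_sharp nd fv2 hi ns).
  + by move=> i hi; exact: (occ_tctx_bound fv1 hi).
  + by move=> ws hlen hws; exact: (close_quantum nd ht hlen hws).
- move=> D t A nd ht; have fv := proj1 typing_sfv _ _ _ ht; split; last split.
  + move=> i hi []; rewrite length_map in hi.
    rewrite (nth_indep _ TU (trC CUnit)) ?length_map; last exact/ltP.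
    by rewrite -(map_map snd trC) map_nth => d; exact: trC_flat.
  + by move=> i /occ_tr[x [/fv hx <-]]; rewrite length_map; exact: idx_names.
  + by move=> ws hlen hws; exact: (close_classical nd ht hlen hws).
- move=> n h kets xs t A nQ ux _ ht; split; [by []|split].
    by move=> i; rewrite (closed_prog ht).
  by move=> [|//] _ _; exact: (realizes_prog ux ht nQ).
Qed.
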